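(* Assume that $\mathbf{E}\ln\rho_0<0$ and that there exists a unique $\kappa>0$ such that $\mathbf{E}[\rho_0^{\kappa}]=1$ and $\mathbf{E}[\rho_0^{\kappa}\ln^+\rho_0]<\infty$. Assume moreover $\kappa>1$. Then for $\mathbf{P}$-almost every environment $\omega$ the sequence of lazy random walks in random environment $(Y^n_k)_{k\in\mathbb{N}_0}$ on $\{0,\dots,n\}$, $n\in\mathbb{N}$, exhibits a cutoff with cutoff times $t_\omega(n):=2E_{\omega^n}(T_n)$ and window size $f_\omega(n):=\sqrt{\mathrm{Var}_{\omega^n}(T_n)}$.
   Context: Environment: $\omega=(\omega_k)_{k\in\mathbb{Z}}$ is a family of i.i.d. random variables with values in $(0,1)$; $\mathbf{P}$ is its law, $\mathbf{E}$ the corresponding expectation, and $\rho_i:=(1-\omega_i)/\omega_i$. Reflected walk: for $n\in\mathbb{N}$ put $\omega^n_0:=1$, $\omega^n_k:=\omega_k$ for $1\le k\le n-1$, $\omega^n_n:=0$. Under $P_{\omega^n}^z$ the (non-lazy) walk $(X_k)_{k\in\mathbb{N}_0}$ is the Markov chain on $\{0,\dots,n\}$ started at $z$ which jumps from $i$ to $i+1$ with probability $\omega^n_i$ and from $i$ to $i-1$ with probability $1-\omega^n_i$. Let $T_n:=\min\{l\in\mathbb{N}_0: X_l=n\}$. $E_{\omega^n}$ and $\mathrm{Var}_{\omega^n}$ denote expectation and variance under $P_{\omega^n}:=P_{\omega^n}^0$. Lazy reflected walk: under $P_{\omega^n}^z$, $(Y^n_k)_{k\in\mathbb{N}_0}$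 is the Markov chain on $\{0,\dots,n\}$ started at $z$ which from $i$ jumps to $i+1$ with probability $\omega^n_i/2$, stays at $i$ with probability $1/2$, and jumps to $i-1$ with probability $(1-\omega^n_i)/2$. Cutoff: for a sequence of aperiodic irreducible Markov chains $(U^n_k)_{k\in\mathbb{N}_0}$ on finite state spaces $\Omega_n$ with $|\Omega_n|\to\infty$ and stationary distributions $\pi_n$, let $d_n(l):=\max_{x\in\Omega_n}\|\mathbb{P}^x(U^n_l\in\cdot)-\pi_n\|_{TV}$ (total variation distance, chain started at $x$). The sequence exhibits a cutoff with cutoff times $(t_n)$ and window size $(f_n)$ if (1) $f_n=o(t_n)$; (2) $\lim_{c\to\infty}\liminf_{n\to\infty}d_n(t_n-cf_n)=1$; (3) $\lim_{c\to\infty}\limsup_{n\to\infty}d_n(t_n+cf_n)=0$. Integer parts are omitted, i.e. $d_n(t)$ means $d_n(\lfloor t\rfloor)$ for real $t\ge 0$. *)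

(* Defs.v *)
From HB Require Import structures.
From mathcomp Require Import all_boot all_order all_algebra.
From mathcomp Require Import all_classical all_reals all_analysis.
Set Implicit Arguments.
Unset Strict Implicit.
Unset Printing Implicit Defensive.
Import Order.TTheory GRing.Theory Num.Theory.
Import numFieldNormedType.Exports.
Local Open Scope classical_set_scope.
Local Open Scope ring_scope.

Section Independence.
Context {R : realType} {d : measure_display} {T : measurableType d}.
Variable P : probability T R.

Definition mutually_independent (I : choiceType) (X : I -> {RV P >-> R}) : Prop :=
  forall (s : seq I) (B : I -> set R),
    uniq s -> (forall i, measurable (B i)) ->
    P (\bigcap_(i in [set` s]) (X i @^-1` B i)) =
      (\prod_(i <- s) P (X i @^-1` B i))%E.

Definition identically_distributed (I : choiceType) (X : I -> {RV P >-> R}) : Prop :=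
  forall (i j : I) (B : set R), measurable B -> P (X i @^-1` B) = P (X j @^-1` B).

Definition iid (I : choiceType) (X : I -> {RV P >-> R}) : Prop :=
  mutually_independent X /\ identically_distributed X.

End Independence.

Section MarkovChains.
Context {R : realType} {d : measure_display} {S : measurableType d} {E : finType}.

(* The Markov property is P(U_0 = u_0, ..., U_l = u_l, U_(l+1) = y)
   = P(U_0 = u_0, ..., U_l = u_l) * p(u_l, y), i.e. the conditional
   probability is cleared of its denominator, so that paths of probability
   zero need no separate treatment. *)
Definition markov_chain (Q : probability S R) (p : E -> E -> R) (x : E)
    (U : nat -> S -> E) : Prop :=
  [/\ forall l y, measurable [set s | U l s = y],
      Q [set s | U 0%N s = x] = 1%E
    & forall l (u : nat -> E) (y : E),
        Q [set s | (forall k, (k <= l)%N -> U k s = u k) /\ U l.+1 s = y] =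
        (Q [set s | forall k, (k <= l)%N -> U k s = u k] * (p (u l) y)%:E)%E].

(* +oo when the state y is never visited *)
Definition hitting_time (U : nat -> S -> E) (y : E) (s : S) : \bar R :=
  ereal_inf [set (l%:R)%:E | l in [set l : nat | U l s = y]].

(* In the next definitions, Q x is the law under which the chain starts at x. *)
Definition step_law (Q : E -> probability S R) (U : nat -> S -> E)
    (x : E) (l : nat) (A : {set E}) : R :=
  fine (Q x [set s | U l s \in A]).

Definition irreducible (Q : E -> probability S R) (U : nat -> S -> E) : Prop :=
  forall x y, exists l, 0 < step_law Q U x l [set y]%SET.

Definition aperiodic (Q : E -> probability S R) (U : nat -> S -> E) : Prop :=
  forall (x : E) (g : nat),
    (forall l, (0 < l)%N -> 0 < step_law Q U x l [set x]%SET -> (g %| l)%N) ->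
    g = 1%N.

Definition stationary (p : E -> E -> R) (pi : E -> R) : Prop :=
  [/\ forall x, 0 <= pi x, \sum_x pi x = 1
    & forall y, \sum_x pi x * p x y = pi y].

Definition total_variation (mu nu : {set E} -> R) : R :=
  \big[Num.max/0]_(A : {set E}) `|mu A - nu A|.

Definition mixing_distance (Q : E -> probability S R) (U : nat -> S -> E)
    (pi : E -> R) (l : nat) : R :=
  \big[Num.max/0]_(x : E)
    total_variation (step_law Q U x l) (fun A => \sum_(y in A) pi y).

End MarkovChains.

(* Sequences are indexed by n >= 1; the terms of index 0 play no role.  Real
   times are rounded down by Num.truncn, which is 0 on negative reals; when
   f = o(t) and t > 0, t n - c * f n is negative for finitely many n only. *)
Definition exhibits_cutoff {R : realType} {d : measure_display}
    (S : nat -> measurableType d) (E : nat -> finType)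
    (Q : forall n, E n -> probability (S n) R) (p : forall n, E n -> E n -> R)
    (U : forall n, nat -> S n -> E n) (t f : nat -> R) : Prop :=
  [/\ forall n, (0 < n)%N ->
        [/\ forall x, markov_chain (Q n x) (p n) x (U n),
            irreducible (Q n) (U n) & aperiodic (Q n) (U n)],
      (#|E n|%:R : R) @[n --> \oo] --> +oo
    & exists pi : forall n, E n -> R,
        let dist n (r : R) := mixing_distance (Q n) (U n) (pi n) (Num.truncn r) in
        [/\ forall n, (0 < n)%N -> stationary (p n) (pi n),
            f =o_\oo t,
            limn_einf (fun n => (dist n (t n - c * f n))%:E) @[c --> +oo] --> 1%E
          & limn_esup (fun n => (dist n (t n + c * f n))%:E) @[c --> +oo] --> 0%E]].

Section RandomWalk.
Context {R : realType}.
Implicit Types (w : int -> R) (n : nat).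

Definition rho w (k : int) : R := (1 - w k) / w k.

Definition reflected_env w n (k : nat) : R :=
  if k == 0%N then 1 else if (k < n)%N then w k%:Z else 0.

Definition walk_kernel w n (i j : 'I_n.+1) : R :=
  if j == i.+1 :> nat then reflected_env w n i
  else if i == j.+1 :> nat then 1 - reflected_env w n i
  else 0.

Definition lazy_kernel w n (i j : 'I_n.+1) : R :=
  if j == i then 2^-1 else walk_kernel w i j / 2.

(* The hitting time of n is almost surely finite for the walks considered, so
   fine only alters it on a null set. *)
Definition walk_time {d : measure_display} {S : measurableType d} n
    (X : nat -> S -> 'I_n.+1) (s : S) : R :=
  fine (hitting_time X ord_max s : \bar R).

End RandomWalk.

(* Main.v *)
Require Import Defs.
From HB Require Import structures.
From mathcomp Require Import all_boot all_order all_algebra.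
From mathcomp Require Import all_classical all_reals all_analysis.
From mathcomp Require Import measurable_realfun.
From mathcomp Require Import ring lra zify.
Set Implicit Arguments.
Unset Strict Implicit.
Unset Printing Implicit Defensive.
Import Order.TTheory GRing.Theory Num.Theory.
Import numFieldNormedType.Exports.
Local Open Scope classical_set_scope.
Local Open Scope ring_scope.

(** The crossing times of consecutive edges are independent under the quenched
law, and their means and variances solve first-order recursions in rho.  A
function q with q(x, s) = E_x[(s + T - a)^2], T a hitting time, is preserved by
one step of the chain, so Chebyshev bounds for T are inductions on the number
of steps.

After the cutoff time, two lazy chains coupled so as to move one at a time
cannot cross, and have met once the lower one has hit n.  Before it, the chain
started at 0 has not yet reached the eps-quantile m of the stationary law; the
point is that E T_n - E T_m is at most of the order of the standard deviation
of T_n, whatever the environment.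

For almost every environment Var T_n is at least linear in n, because
1 / omega <= exp rho and the product of the omega_i decays exponentially, and
it is o(n^2), because for 1 < s < kappa the moment of order s / 2 of the
variance of a crossing time is bounded. *)

(** * Crossing times and kernels *)

(** The obstacle is to compare E T_n - E T_m with the standard deviation in a fixed environment,
    where no asymptotics are available; it is overcome edge by edge. Let c_i be the conductances and
    E_i, V_i the mean and variance of the crossing time of edge i. Then c_i E_i is the unnormalized
    stationary mass of [0, i], and c_i V_i is at least the sum of c_j E_j^2 over j < i. To the right
    of the quantile the masses of [0, i] and [0, j] differ by a factor at most 1 / eps, so E_i E_j
    <= c_j E_j^2 / (eps c_i), and summation over j < i gives V_i / eps. In the square of the sum of
    the E_i only the diagonal remains, and E_i^2 <= 2 V_i + 2.

    The additive constants sum to a multiple of n, and laziness adds a mean to the second moment;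
    the linear lower bound on Var T_n absorbs both. The bound o(n^2) makes the window negligible,
    because E T_n >= n. In its proof s > 1 makes 2^((1 - s) k) summable in k, s <= 2 makes the power
    s / 2 subadditive, and s < kappa makes the independent factors contract in mean. *)

Definition kernel_op {R : realType} {E : finType} (p : E -> E -> R) (g : E -> R)
  (x : E) : R := \sum_y p x y * g y.

Section Crossing.
Context {R : realType}.
Implicit Types (r : nat -> R) (i j k n x : nat).

(* Mean and variance of the time from i to i + 1: the walk makes a geometric
   number of backward steps from i, of mean r i, and each of them is followed
   by a crossing of the previous edge. *)
Fixpoint crossing_mean r i : R :=
  if i is j.+1 then 1 + r i * (1 + crossing_mean r j) else 1.

Fixpoint crossing_var r i : R :=
  if i is j.+1 then
    r i * crossing_var r j + r i * (1 + r i) * (1 + crossing_mean r j) ^+ 2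
  else 0.

(* Conductance of the edge {i, i + 1} *)
Fixpoint conductance r i : R :=
  if i is j.+1 then conductance r j / r i else 1.

(** The sums are empty for x >= n, which builds in the boundary value 0 at the target. *)
Definition mean_to r n x : R := \sum_(x <= i < n) crossing_mean r i.
Definition var_to r n x : R := \sum_(x <= i < n) crossing_var r i.

Variable r : nat -> R.
Hypothesis r_gt0 : forall k, 0 < r k.
Local Notation cm := (crossing_mean r).
Local Notation cv := (crossing_var r).
Local Notation cc := (conductance r).

Lemma crossing_mean_ge1 i : 1 <= cm i.
Proof.
elim: i => [|i IH] //=; rewrite lerDl mulr_ge0 ?(ltW (r_gt0 _)) //.
by rewrite addr_ge0 // (le_trans ler01 IH).
Qed.

Lemma crossing_var_ge0 i : 0 <= cv i.
Proof.
elim: i => [|i IH] //=; have r0 := ltW (r_gt0 i.+1).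
by rewrite addr_ge0 ?mulr_ge0 ?addr_ge0 // ?exprn_ge0 ?addr_ge0 ?(le_trans ler01 (crossing_mean_ge1 _)).
Qed.

Lemma conductance_gt0 i : 0 < cc i.
Proof. by elim: i => [|i IH] //=; rewrite divr_gt0. Qed.

Lemma mean_to_ge0 n x : 0 <= mean_to r n x.
Proof. by apply: sumr_ge0 => i _; exact: le_trans ler01 (crossing_mean_ge1 i). Qed.

Lemma var_to_ge0 n x : 0 <= var_to r n x.
Proof. by apply: sumr_ge0 => i _; exact: crossing_var_ge0 i. Qed.

Lemma mean_to_le n x : mean_to r n x <= mean_to r n 0.
Proof.
have [xn|/ltnW nx] := leqP x n.
  by rewrite [leRHS](big_cat_nat (leq0n x) xn) /= lerDr sumr_ge0 // => i _; apply: le_trans ler01 (crossing_mean_ge1 i).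
by rewrite {1}/mean_to big_geq // mean_to_ge0.
Qed.

Lemma var_to_le n x : var_to r n x <= var_to r n 0.
Proof.
have [xn|/ltnW nx] := leqP x n.
  by rewrite [leRHS](big_cat_nat (leq0n x) xn) /= lerDr sumr_ge0 // => i _; apply: crossing_var_ge0 i.
by rewrite {1}/var_to big_geq // var_to_ge0.
Qed.

Lemma mean_to_size n : n%:R <= mean_to r n 0.
Proof.
rewrite -[n in n%:R]subn0 -[leLHS]mulr1 mulr_natl -sumr_const_nat /mean_to.
by apply: ler_sum => i _; exact: crossing_mean_ge1.
Qed.

Lemma mean_to_ltn n x : (x < n)%N -> mean_to r n x = cm x + mean_to r n x.+1.
Proof. by move=> xn; rewrite /mean_to big_ltn. Qed.

Lemma var_to_ltn n x : (x < n)%N -> var_to r n x = cv x + var_to r n x.+1.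
Proof. by move=> xn; rewrite /var_to big_ltn. Qed.

(** Once the crossings of the edges at x - 1 and x are split off from the sums, the recursions for
    [crossing_mean] and [crossing_var] turn this into a rational identity in e, the tails being
    common to both sides. *)
Lemma second_moment_step n x (e a s : R) : (0 < x < n)%N ->
    0 < e -> r x = (1 - e) / e ->
  e * (var_to r n x.+1 + (s + 1 + mean_to r n x.+1 - a) ^+ 2)
    + (1 - e) * (var_to r n x.-1 + (s + 1 + mean_to r n x.-1 - a) ^+ 2)
  = var_to r n x + (s + mean_to r n x - a) ^+ 2.
Proof.
case: x => // x /= xn e0 rx.
rewrite (var_to_ltn (ltnW xn)) (mean_to_ltn (ltnW xn)).
rewrite (var_to_ltn xn) (mean_to_ltn xn) /= rx.
by field; rewrite gt_eqF.
Qed.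

Lemma mean_step n x (e s : R) : (0 < x < n)%N ->
    0 < e -> r x = (1 - e) / e ->
  e * (s + 1 + mean_to r n x.+1) + (1 - e) * (s + 1 + mean_to r n x.-1)
  = s + mean_to r n x.
Proof.
case: x => // x /= xn e0 rx.
rewrite (mean_to_ltn (ltnW xn)) (mean_to_ltn xn) /= rx.
by field; rewrite gt_eqF.
Qed.

End Crossing.

Section Kernels.
Context {R : realType}.
Variables (w : int -> R) (n : nat).
Hypothesis w01 : forall k, 0 < w k < 1.
Hypothesis n_gt0 : (0 < n)%N.
Implicit Types (x : 'I_n.+1) (g : nat -> R).

Let r (k : nat) : R := rho w k.
Let env := reflected_env w n.

Lemma rho_gt0 k : 0 < rho w k.
Proof. by have /andP[w0 w1] := w01 k; rewrite divr_gt0 // subr_gt0. Qed.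

Lemma reflected_env_ge0 k : 0 <= env k <= 1.
Proof.
rewrite /env /reflected_env; case: ifP => _; first by rewrite ler01 lexx.
case: ifP => _; last by rewrite ler01 lexx.
by have /andP[/ltW -> /ltW ->] := w01 k.
Qed.

(** The function g lives on all of nat: at the ends the values at n + 1 and at the truncated
    predecessor of 0 get coefficient 0. *)
Lemma walk_kernelE g x :
  kernel_op (@walk_kernel R w n) (fun y => g y) x =
  env x * g x.+1 + (1 - env x) * g x.-1.
Proof.
rewrite /kernel_op /walk_kernel.
transitivity (\sum_(y < n.+1) ((if y == x.+1 :> nat then env x * g x.+1 else 0) +
     (if x == y.+1 :> nat then (1 - env x) * g x.-1 else 0))).
  apply: eq_bigr => y _; case: eqP => [yx|yx].
    by rewrite yx ifF ?addr0 //; lia.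
  by case: eqP => [->|_]; rewrite ?add0r // ?mul0r.
rewrite big_split /=; congr (_ + _).
- have [xn|] := ltnP x n.
    rewrite (bigD1 (inord x.+1)) //= inordK // eqxx big1 ?addr0 // => i /eqP ix.
    case: eqP => // ix'; case: ix; apply: val_inj; rewrite /= inordK //.
  move=> nx; have xn : x = n :> nat by apply/eqP; rewrite eqn_leq nx -ltnS ltn_ord.
  rewrite big1 => [|i _]; last by rewrite ifF //; apply/eqP; have := ltn_ord i; lia.
  by rewrite /env /reflected_env xn ltnn ifF ?mul0r //; lia.
- have [x0|x0] := posnP x.
    rewrite big1 => [|i _]; last by rewrite ifF //; apply/eqP; lia.
    by rewrite /env /reflected_env x0 eqxx subrr mul0r.
  have xn := ltn_ord x.
  rewrite (bigD1 (inord x.-1)) //= inordK; last lia.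
  rewrite prednK // eqxx big1 ?addr0 // => i /eqP ix.
  case: eqP => // ix'; case: ix; apply: val_inj; rewrite /= inordK; lia.
Qed.

Lemma walk_kernel_ge0 x y : 0 <= @walk_kernel R w n x y.
Proof.
have /andP[e0 e1] := reflected_env_ge0 x.
by rewrite /walk_kernel; case: ifP => // _; case: ifP => // _; rewrite subr_ge0.
Qed.

Lemma lazy_kernelE_op (g : 'I_n.+1 -> R) x :
  kernel_op (@lazy_kernel R w n) g x =
  (g x + kernel_op (@walk_kernel R w n) g x) / 2.
Proof.
rewrite /kernel_op (bigD1 x) //= [in RHS](bigD1 x) //=.
rewrite /lazy_kernel eqxx {2}/walk_kernel !ifF; [|lia|lia].
rewrite mul0r add0r mulrDl mulrC; congr (_ + _).
rewrite mulr_suml; apply: eq_bigr => y yx.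
by rewrite (negbTE yx) mulrAC.
Qed.

Lemma lazy_kernel_ge0 x y : 0 <= @lazy_kernel R w n x y.
Proof.
rewrite /lazy_kernel; case: ifP => _ //.
by rewrite divr_ge0 // walk_kernel_ge0.
Qed.

Lemma lazy_kernel_sum x : \sum_y @lazy_kernel R w n x y = 1.
Proof.
transitivity (kernel_op (@lazy_kernel R w n) (fun=> 1) x).
  by apply: eq_bigr => y _; rewrite mulr1.
by rewrite lazy_kernelE_op (walk_kernelE (fun=> 1)); field.
Qed.

(* E_x[(s + T - a)^2] for the hitting time T of m, for the walk and for the lazy
   walk; a lazy step takes a geometric time of mean 2 and variance 2, whence the
   variance 4 Var + 2 E. *)
Definition walk_moment m (a : R) (x : nat) (s : R) :=
  var_to r m x + (s + mean_to r m x - a) ^+ 2.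

Definition lazy_moment m (a : R) (x : nat) (s : R) :=
  4 * var_to r m x + 2 * mean_to r m x + (s + 2 * mean_to r m x - a) ^+ 2.

Lemma walk_moment_step m a x s : (x < m <= n)%N ->
  kernel_op (@walk_kernel R w n) (fun y => walk_moment m a y (s + 1)) x
  = walk_moment m a x s.
Proof.
move=> /andP[xm mn].
rewrite (walk_kernelE (fun y => walk_moment m a y (s + 1))) /walk_moment.
have [x0|x0] := posnP x.
  rewrite /env /reflected_env x0 eqxx /= subrr mul0r addr0 mul1r.
  have m0 : (0 < m)%N by rewrite -x0.
  by rewrite (var_to_ltn _ m0) (mean_to_ltn _ m0) /=; ring.
have xn : (x < n)%N by exact: leq_trans mn.
rewrite /env /reflected_env (gtn_eqF x0) xn.
by apply: second_moment_step; rewrite ?x0 //; have /andP[] := w01 x.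
Qed.

Lemma walk_mean_step m x s : (x < m <= n)%N ->
  kernel_op (@walk_kernel R w n) (fun y => s + 1 + mean_to r m y) x
  = s + mean_to r m x.
Proof.
move=> /andP[xm mn].
rewrite (walk_kernelE (fun y => s + 1 + mean_to r m y)).
have [x0|x0] := posnP x.
  rewrite /env /reflected_env x0 eqxx /= subrr mul0r addr0 mul1r.
  have m0 : (0 < m)%N by rewrite -x0.
  by rewrite (mean_to_ltn _ m0) /=; ring.
have xn : (x < n)%N by exact: leq_trans mn.
rewrite /env /reflected_env (gtn_eqF x0) xn.
by apply: mean_step; rewrite ?x0 //; have /andP[] := w01 x.
Qed.

Lemma lazy_moment_step m a x s : (x < m <= n)%N ->
  kernel_op (@lazy_kernel R w n) (fun y => lazy_moment m a y (s + 1)) x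
  = lazy_moment m a x s.
Proof.
move=> xmn.
rewrite lazy_kernelE_op.
(* The instance centred at the current mean expresses the variance at x; together with the mean
   identity it yields the lazy equation for all [a] and [s]. *)
have H1 := walk_moment_step (mean_to r m x) 0 xmn.
have H2 := walk_mean_step 0 xmn.
move: H1 H2.
rewrite (walk_kernelE (fun y => walk_moment m (mean_to r m x) y (0 + 1))).
rewrite (walk_kernelE (fun y => 0 + 1 + mean_to r m y)).
rewrite (walk_kernelE (fun y => lazy_moment m a y (s + 1))) /walk_moment /lazy_moment.
set e := env x; set v1 := var_to r m x.+1; set v0 := var_to r m x.-1; set v := var_to r m x.
set m1 := mean_to r m x.+1; set m0 := mean_to r m x.-1; set M := mean_to r m x.
move=> H1 H2.
have -> : v = e * (v1 + (0 + 1 + m1 - M) ^+ 2) + (1 - e) * (v0 + (0 + 1 + m0 - M) ^+ 2).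
  by rewrite H1; ring.
have -> : M = e * (0 + 1 + m1) + (1 - e) * (0 + 1 + m0) by rewrite H2; ring.
by field.
Qed.

End Kernels.

(** * Coupling and tail bounds for the lazy walk *)

Section KernelOp.
Context {R : realType} {E : finType}.
Variable p : E -> E -> R.
Hypothesis p_ge0 : forall x y, 0 <= p x y.
Hypothesis p_sum : forall x, \sum_y p x y = 1.

Lemma kernel_op_le (g h : E -> R) x :
  (forall y, p x y != 0 -> g y <= h y) -> kernel_op p g x <= kernel_op p h x.
Proof.
move=> gh; apply: ler_sum => y _.
have [->|py] := eqVneq (p x y) 0; first by rewrite !mul0r.
by rewrite ler_wpM2l // gh.
Qed.

Lemma kernel_opZ (g : E -> R) c x :
  kernel_op p (fun y => c * g y) x = c * kernel_op p g x.
Proof. by rewrite /kernel_op mulr_sumr; apply: eq_bigr => y _; rewrite mulrCA. Qed.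

Lemma kernel_op_cst c x : kernel_op p (fun=> c) x = c.
Proof. by rewrite /kernel_op -mulr_suml p_sum mul1r. Qed.

Lemma kernel_opB (g h : E -> R) x :
  kernel_op p (fun y => g y - h y) x = kernel_op p g x - kernel_op p h x.
Proof. by rewrite /kernel_op -sumrB; apply: eq_bigr => y _; rewrite mulrBr. Qed.

Lemma iter_kernel_op_itv (g : E -> R) l x :
  (forall y, 0 <= g y <= 1) -> 0 <= iter l (kernel_op p) g x <= 1.
Proof.
move=> g01; elim: l x => [|l IH] x //=; apply/andP; split.
  rewrite -(kernel_op_cst 0 x); apply: kernel_op_le => y _.
  by have /andP[] := IH y.
rewrite -[leRHS](kernel_op_cst 1 x); apply: kernel_op_le => y _.
by have /andP[] := IH y.
Qed.

End KernelOp.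

Section LazyBounds.
Context {R : realType}.
Variables (w : int -> R) (n : nat).
Hypothesis w01 : forall k, 0 < w k < 1.
Hypothesis n_gt0 : (0 < n)%N.
Let r (k : nat) : R := rho w k.
Let r_gt0 k : 0 < r k.
Proof. exact: rho_gt0. Qed.
Let L := kernel_op (@lazy_kernel R w n).

Lemma lazy_moment_ge0 m a x s : 0 <= lazy_moment w m a x s.
Proof.
rewrite /lazy_moment addr_ge0 ?sqr_ge0 // addr_ge0 // mulr_ge0 //.
  exact: var_to_ge0.
exact: mean_to_ge0.
Qed.

Lemma lazy_moment_target m a x s : (m <= x)%N ->
  lazy_moment w m a x s = (s - a) ^+ 2.
Proof.
by move=> mx; rewrite /lazy_moment /var_to /mean_to !big_geq // !mulr0 !add0r addr0.
Qed.

(** Chebyshev's inequality for the hitting time of m, with k steps left and l - k elapsed: a chain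
    beyond m after l steps has hit m by time l <= a, hence at distance at least a - l from a. *)
Lemma lazy_lower_tail (m l k : nat) (a : R) (x : 'I_n.+1) :
    (m <= n)%N -> (k <= l)%N -> l%:R <= a ->
  (a - l%:R) ^+ 2 * iter k L (fun y => (m <= y)%N%:R) x
    <= lazy_moment w m a x (l - k)%:R.
Proof.
move=> mn; elim: k x => [|k IH] x kl la.
  rewrite /= subn0; have [mx|xm] := leqP m x; last by rewrite mulr0 lazy_moment_ge0.
  by rewrite lazy_moment_target // mulr1 -sqrrN opprB.
have [mx|xm] := leqP m x.
  rewrite lazy_moment_target //.
  have /andP[i0 i1] : 0 <= iter k.+1 L (fun y : 'I_n.+1 => (m <= y)%N%:R) x <= 1.
    apply: iter_kernel_op_itv => [y z|y|y].
    - exact: lazy_kernel_ge0.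
    - exact: lazy_kernel_sum.
    - by case: (m <= y)%N; rewrite ?lexx ?ler01.
  apply: (@le_trans _ _ ((a - l%:R) ^+ 2)); first by rewrite ler_piMr ?sqr_ge0.
  rewrite -[leRHS]sqrrN opprB lerXn2r ?nnegrE ?subr_ge0 //.
    by apply: le_trans la; rewrite ler_nat leq_subr.
  by rewrite lerD2l lerN2 ler_nat leq_subr.
rewrite iterS -kernel_opZ -(@lazy_moment_step _ w n w01 n_gt0 m) ?xm //.
apply: kernel_op_le => [y z|y _]; first exact: lazy_kernel_ge0.
by rewrite natr1 subnSK //; apply: IH => //; exact: ltnW.
Qed.

Lemma walk_kernel_neighbour (x y : 'I_n.+1) : @walk_kernel R w n x y != 0 ->
  (y == x.+1 :> nat) || (x == y.+1 :> nat).
Proof. by rewrite /walk_kernel; case: ifP => //; case: ifP => //; rewrite eqxx. Qed.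

(* Two copies of the lazy chain are coupled so that exactly one of them moves at
   each step; they cannot jump over each other, hence have met by the time the
   lower one hits n. *)
Lemma lazy_coupling (l k : nat) (a : R) (g : 'I_n.+1 -> R) (x y : 'I_n.+1) :
    (forall z, 0 <= g z <= 1) -> (k <= l)%N -> a <= l%:R -> (x <= y)%N ->
  (l%:R - a) ^+ 2 * `|iter k L g x - iter k L g y|
    <= lazy_moment w n a x (l - k)%:R.
Proof.
move=> g01; elim: k x y => [|k IH] x y kl la.
  rewrite subn0 /= leq_eqVlt => /orP[/eqP/val_inj ->|xy].
    by rewrite subrr normr0 mulr0 lazy_moment_ge0.
  have /andP[gx0 gx1] := g01 x; have /andP[gy0 gy1] := g01 y.
  apply: (@le_trans _ _ ((l%:R - a) ^+ 2)).
    by rewrite ler_piMr ?sqr_ge0 // ler_norml; lra.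
  have m0 := mean_to_ge0 r_gt0 n x; have v0 := var_to_ge0 r_gt0 n x.
  rewrite /lazy_moment -[leLHS]add0r lerD //; first lra.
  by rewrite lerXn2r ?nnegrE; lra.
rewrite leq_eqVlt => /orP[/eqP/val_inj ->|xy].
  by rewrite subrr normr0 mulr0 lazy_moment_ge0.
set f := iter k L g.
have Ksum z : \sum_u @walk_kernel R w n z u = 1.
  transitivity (kernel_op (@walk_kernel R w n) (fun=> 1) z).
    by apply: eq_bigr => u _; rewrite mulr1.
  by rewrite (walk_kernelE w n_gt0 (fun=> 1)); ring.
(* The coupling in analytic form: with probability one half the lower copy makes a non-lazy step
   while the upper one rests, otherwise the roles are exchanged. *)
have -> : iter k.+1 L g x - iter k.+1 L g y =
    (kernel_op (@walk_kernel R w n) (fun z => f z - f y) x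
     + kernel_op (@walk_kernel R w n) (fun z => f x - f z) y) / 2.
  rewrite !kernel_opB !kernel_op_cst // !iterS /L !lazy_kernelE_op // -/L -/f.
  by field.
rewrite -(@lazy_moment_step _ w n w01 n_gt0 n) ?leqnn ?andbT; last first.
  by apply: leq_trans xy _; rewrite -ltnS.
rewrite lazy_kernelE_op // natr1 subnSK //.
set q := fun z : 'I_n.+1 => lazy_moment w n a z (l - k)%:R.
have kl' := ltnW kl.
have K0 z u : 0 <= @walk_kernel R w n z u by exact: walk_kernel_ge0.
rewrite normrM (ger0_norm (_ : 0 <= 2^-1)) ?invr_ge0 // mulrA.
rewrite ler_pM2r ?invr_gt0 //.
set c := (_ - _) ^+ 2.
have c0 : 0 <= c by exact: sqr_ge0.
have norm_op h z : c * `|kernel_op (@walk_kernel R w n) h z|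
    <= kernel_op (@walk_kernel R w n) (fun u => c * `|h u|) z.
  rewrite kernel_opZ ler_wpM2l // (le_trans (ler_norm_sum _ _ _)) //.
  by apply: ler_sum => u _; rewrite normrM ger0_norm.
apply: (le_trans (ler_wpM2l c0 (ler_normD _ _))).
(* A move of the upper copy leaves the bound unchanged, since it depends on the lower position only.
   As x < y, a step to a neighbour can produce a meeting but no crossing. *)
rewrite mulrDr addrC; apply: lerD.
  apply: (le_trans (norm_op _ _)).
  rewrite -[leRHS](kernel_op_cst Ksum _ y); apply: kernel_op_le => // u.
  move/walk_kernel_neighbour => uy; apply: IH => //; lia.
apply: (le_trans (norm_op _ _)).
apply: kernel_op_le => // u /walk_kernel_neighbour ux; apply: IH => //; lia.
Qed.

End LazyBounds.

(** * The stationary law *)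

Section ReversibleMeasure.
Context {R : realType}.
Variables (w : int -> R) (n : nat).
Hypothesis w01 : forall k, 0 < w k < 1.
Hypothesis n_gt0 : (0 < n)%N.
Let r (k : nat) : R := rho w k.
Let r_gt0 k : 0 < r k.
Proof. exact: rho_gt0. Qed.
Local Notation cc := (conductance r).
Local Notation cm := (crossing_mean r).
Local Notation cv := (crossing_var r).

(** Total conductance of the edges at k, where 0 has no edge to its left and n none to its right. *)
Definition reversible_mass (k : nat) : R :=
  (if k == 0%N then 0 else cc k.-1) + (if (k < n)%N then cc k else 0).

Definition reversible_total : R := \sum_(0 <= k < n.+1) reversible_mass k.

Definition reversible_prob (x : 'I_n.+1) : R :=
  reversible_mass x / reversible_total.

Lemma reversible_mass_ge0 k : 0 <= reversible_mass k.
Proof.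
by rewrite /reversible_mass addr_ge0 //; case: ifP => // _; rewrite ltW // conductance_gt0.
Qed.

(** Multiplied by the conductance of its edge, the recursion for the mean adds the conductances of
    the two edges at the new vertex. The restriction i < n leaves out the last vertex, which has a
    single edge. *)
Lemma sum_reversible_mass i : (i < n)%N ->
  \sum_(0 <= k < i.+1) reversible_mass k = cc i * cm i.
Proof.
elim: i => [|i IH] iN.
  by rewrite big_nat1 /reversible_mass /= n_gt0 add0r mulr1.
rewrite big_nat_recr //= IH ?(ltnW iN) // /reversible_mass /= iN.
by field; rewrite gt_eqF.
Qed.

Lemma reversible_total_gt0 : 0 < reversible_total.
Proof.
rewrite /reversible_total big_nat_recr //= -{1}(prednK n_gt0).
rewrite sum_reversible_mass ?prednK // ltr_pwDl ?reversible_mass_ge0 // mulr_gt0 //.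
  exact: conductance_gt0.
by rewrite (lt_le_trans ltr01) // crossing_mean_ge1.
Qed.

Lemma reversible_mass_right k :
  reversible_mass k * reflected_env w n k = if (k < n)%N then cc k else 0.
Proof.
rewrite /reversible_mass /reflected_env; case: k => [|k] /=.
  by rewrite n_gt0 add0r mulr1.
case: ifP => _; last by rewrite mulr0.
rewrite /r /rho; have /andP[w0 w1] := w01 k.+1.
by field; rewrite subr_eq0 !gt_eqF.
Qed.

Lemma reversible_mass_left k : (k <= n)%N ->
  reversible_mass k * (1 - reflected_env w n k) = if k == 0%N then 0 else cc k.-1.
Proof.
by move=> kn; rewrite mulrBr mulr1 reversible_mass_right /reversible_mass addrK.
Qed.

Lemma walk_kernel_reversible (x y : 'I_n.+1) :
  reversible_mass x * @walk_kernel R w n x y =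
  reversible_mass y * @walk_kernel R w n y x.
Proof.
rewrite /walk_kernel.
have xn : (x <= n)%N by rewrite -ltnS.
have yn : (y <= n)%N by rewrite -ltnS.
have [yx|yx] := eqVneq (y : nat) x.+1.
  rewrite ifF; last lia.
  by rewrite reversible_mass_right reversible_mass_left // yx /= -yx yn.
have [xy|xy] := eqVneq (x : nat) y.+1; last by rewrite !mulr0.
by rewrite reversible_mass_right reversible_mass_left // xy /= -xy xn.
Qed.

Lemma lazy_kernel_stationary : stationary (@lazy_kernel R w n) reversible_prob.
Proof.
have Z0 := reversible_total_gt0; split.
- by move=> x; rewrite divr_ge0 ?reversible_mass_ge0 // ltW.
- rewrite -mulr_suml -(big_mkord xpredT reversible_mass) -/reversible_total.
  by rewrite divff // gt_eqF.
- move=> y.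
  transitivity (\sum_x reversible_prob y * @lazy_kernel R w n y x); last first.
    by rewrite -mulr_sumr lazy_kernel_sum // mulr1.
  apply: eq_bigr => x _; rewrite /lazy_kernel (eq_sym x y).
  case: eqP => [->//|_]; rewrite /reversible_prob.
  rewrite ![_ / reversible_total * _]mulrAC; congr (_ / _).
  by rewrite !mulrA walk_kernel_reversible.
Qed.

(** The part r^2 (1 + cm)^2 of the variance recursion is exactly this square. *)
Lemma crossing_var_ge_sqr i : (cm i - 1) ^+ 2 <= cv i.
Proof.
case: i => [|i] /=; first by rewrite subrr expr0n.
have r0 := ltW (r_gt0 i.+1).
have v0 := mulr_ge0 r0 (crossing_var_ge0 r_gt0 i).
have m0 := mulr_ge0 r0 (sqr_ge0 (1 + cm i)); nra.
Qed.

(** Multiplication by the conductance removes the factor r from the variance recursion: c_i cv_i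
    increases at each step by c_i (1 + r) (1 + cm_i)^2, at least c_i cm_i^2. *)
Lemma sum_conductance_le_var i :
  \sum_(0 <= j < i) cc j * cm j ^+ 2 <= cc i * cv i.
Proof.
elim: i => [|i IH]; first by rewrite big_nil /= mulr0.
rewrite big_nat_recr //=.
have -> : cc i / r i.+1 * (r i.+1 * cv i + r i.+1 * (1 + r i.+1) * (1 + cm i) ^+ 2)
   = cc i * cv i + cc i * ((1 + r i.+1) * (1 + cm i) ^+ 2).
  by field; rewrite gt_eqF.
apply: lerD => //; rewrite ler_wpM2l ?(ltW (conductance_gt0 _ _)) //.
have m1 := crossing_mean_ge1 r_gt0 i; have r1 := r_gt0 i.+1.
have m2 : cm i ^+ 2 <= (1 + cm i) ^+ 2 by rewrite lerXn2r ?nnegrE; lra.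
have := mulr_ge0 (ltW r1) (sqr_ge0 (1 + cm i)); lra.
Qed.

Lemma sqr_sum_nat (f : nat -> R) (m k : nat) :
  (\sum_(m <= i < k) f i) ^+ 2 =
  \sum_(m <= i < k) (f i ^+ 2 + 2 * (f i * \sum_(m <= j < i) f j)).
Proof.
have [km|/ltnW mk] := leqP k m; first by rewrite !big_geq // expr0n.
elim: k mk => [|k IH]; first by rewrite leqn0 => /eqP ->; rewrite !big_geq // expr0n.
rewrite leq_eqVlt => /orP[/eqP <-|]; first by rewrite !big_geq // expr0n.
by rewrite ltnS => mk; rewrite !big_nat_recr //= -IH //; ring.
Qed.

(* Beyond the eps-quantile m of the stationary law the mean crossing times
   c_i * cm_i = pi[0, i] are within a factor eps of 1 / c_i, which makes the
   variance comparable with the square of the mean. *)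
Lemma quantile_mean_le (eps : R) : 0 < eps < 1 ->
  exists2 m, (m <= n)%N &
    \sum_(x < n.+1 | (x < m)%N) reversible_prob x <= eps /\
    mean_to r n m ^+ 2 <= (2 + 2 / eps) * var_to r n 0 + 2 * n%:R.
Proof.
move=> /andP[e0 e1].
pose F m := \sum_(0 <= k < m) reversible_mass k.
have Z0 : 0 < reversible_total := reversible_total_gt0.
have Fle a b : (a <= b)%N -> F a <= F b.
  move=> ab; rewrite /F (big_cat_nat (leq0n a) ab) /= lerDl.
  by apply: sumr_ge0 => k _; exact: reversible_mass_ge0.
(* [F m.+1] is the mass of [0, m] and [F m] that of the points strictly below m; the least such m
   therefore leaves at most a fraction eps below itself. *)
have exm : exists m, (fun m => eps * reversible_total <= F m.+1) m.
  exists n; rewrite /F -/reversible_total; nra.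
have [m mP mmin] := ex_minnP exm.
have mn : (m <= n)%N by apply: mmin; rewrite /F -/reversible_total; nra.
exists m => //; split.
  rewrite /reversible_prob -mulr_suml ler_pdivrMr //.
  have -> : \sum_(x < n.+1 | (x < m)%N) reversible_mass x = F m.
    by rewrite /F (big_nat_widen _ _ n.+1) ?(leqW mn) // big_mkord.
  case: m mP mmin mn => [|m] mP mmin mn.
    by rewrite /F big_nil mulr_ge0 // ltW.
  rewrite leNgt; apply/negP => /ltW /mmin; by rewrite ltnn.
rewrite /mean_to sqr_sum_nat.
have key i : (m <= i < n)%N ->
    cm i ^+ 2 + 2 * (cm i * \sum_(m <= j < i) cm j) <= (2 + 2 / eps) * cv i + 2.
  move=> /andP[mi iN].
  have ci := conductance_gt0 r_gt0 i.
  (* This is 2 (cm - 1)^2 + 2 = cm^2 + (cm - 2)^2. *)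
  have H1 : cm i ^+ 2 <= 2 * cv i + 2.
    have := crossing_var_ge_sqr i; have := sqr_ge0 (cm i - 2); nra.
  suff H2 : cm i * \sum_(m <= j < i) cm j <= cv i / eps.
    have -> : (2 + 2 / eps) * cv i + 2 = 2 * cv i + 2 + 2 * (cv i / eps).
      by field; rewrite gt_eqF.
    lra.
  (* Termwise, eps c_i cm_i <= eps Z <= c_j cm_j with Z the total mass, because j >= m. *)
  apply: (@le_trans _ _ (\sum_(m <= j < i) cc j * cm j ^+ 2 / (eps * cc i))).
    rewrite mulr_sumr !big_nat; apply: ler_sum => j /andP[mj ji].
    have cj := conductance_gt0 r_gt0 j.
    have jn := ltn_trans ji iN.
    have Fi : F i.+1 = cc i * cm i by exact: sum_reversible_mass.
    have Fj : F j.+1 = cc j * cm j by exact: sum_reversible_mass.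
    have FiZ : F i.+1 <= reversible_total by apply: Fle; exact: ltnW.
    have Fje : eps * reversible_total <= F j.+1 by apply: le_trans mP _; exact: Fle.
    have mj0 : 0 <= cm j by rewrite (le_trans ler01) // crossing_mean_ge1.
    rewrite ler_pdivlMr ?mulr_gt0 //.
    have -> : cm i * cm j * (eps * cc i) = cm j * (eps * F i.+1) by rewrite Fi; ring.
    have -> : cc j * cm j ^+ 2 = cm j * F j.+1 by rewrite Fj; ring.
    rewrite ler_wpM2l //; apply: le_trans Fje; by rewrite ler_wpM2l // ltW.
  rewrite -mulr_suml ler_pdivrMr ?mulr_gt0 //.
  have -> : cv i / eps * (eps * cc i) = cc i * cv i by field; rewrite gt_eqF.
  apply: le_trans (sum_conductance_le_var i).
  rewrite [leRHS](big_cat_nat (leq0n m) mi) /= lerDr.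
  apply: sumr_ge0 => j _; rewrite mulr_ge0 ?sqr_ge0 //.
  exact/ltW/conductance_gt0.
apply: (@le_trans _ _ (\sum_(m <= i < n) ((2 + 2 / eps) * cv i + 2))).
  by rewrite !big_nat; apply: ler_sum => i; exact: key.
rewrite big_split /= -mulr_sumr sumr_const_nat -[2 *+ _]mulr_natr.
apply: lerD.
  rewrite ler_wpM2l //; first by rewrite addr_ge0 ?divr_ge0 ?(ltW e0).
  exact: (var_to_le r_gt0).
by rewrite ler_wpM2l // ler_nat leq_subr.
Qed.

End ReversibleMeasure.

(** * Laws and hitting times of Markov chains *)

Section FiniteValued.
Context {R : realType} {d : measure_display} {S : measurableType d} {A : finType}.
Variables (Q : probability S R) (W : S -> A).
Hypothesis mW : forall a, measurable [set s | W s = a].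

Lemma finite_valued_sum (F : A -> R) s :
  F (W s) = \sum_a F a * \1_[set s | W s = a] s.
Proof.
rewrite (bigD1 (W s)) //= indicE mem_set // mulr1 big1 ?addr0 // => a aW.
rewrite indicE memNset ?mulr0 //= => /esym/eqP.
by rewrite (negbTE aW).
Qed.

Lemma measurable_finite_valued (F : A -> R) : measurable_fun setT (F \o W).
Proof.
rewrite (_ : F \o W = fun s => \sum_a F a * \1_[set s | W s = a] s).
  apply: measurable_sum => a; apply: measurable_funM; first exact: measurable_cst.
  exact: measurable_indic.
by apply/funext => s /=; rewrite -finite_valued_sum.
Qed.

Lemma integral_finite_valued (F : A -> R) : (forall a, 0 <= F a) ->
  (\int[Q]_s (F (W s))%:E = (\sum_a F a * fine (Q [set s | W s = a]))%:E)%E.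
Proof.
move=> F0.
under eq_integral do rewrite finite_valued_sum -sumEFin.
rewrite ge0_integral_sum //; last 2 first.
- move=> a; apply/measurable_EFinP; apply: measurable_funM.
    exact: measurable_cst.
  exact: measurable_indic.
- by move=> a s _; rewrite lee_fin mulr_ge0.
rewrite -sumEFin; apply: eq_bigr => a _.
under eq_integral do rewrite EFinM.
rewrite ge0_integralZl_EFin //; last first.
  by apply/measurable_EFinP; exact: measurable_indic.
by rewrite integral_indic // setIT EFinM fineK // fin_num_measure.
Qed.

End FiniteValued.

Section MarkovLaw.
Context {R : realType} {d : measure_display} {S : measurableType d} {E : finType}.
Variables (Q : probability S R) (p : E -> E -> R) (x : E) (U : nat -> S -> E).
Hypothesis p_ge0 : forall y z, 0 <= p y z.
Hypothesis mcU : markov_chain Q p x U.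

Let mU l y : measurable [set s | U l s = y].
Proof. by case: mcU. Qed.

Definition chain_prefix l s : {ffun 'I_l.+1 -> E} := [ffun k : 'I_l.+1 => U k s].

Lemma chain_prefixE l (u : {ffun 'I_l.+1 -> E}) :
  [set s | chain_prefix l s = u] =
  [set s | forall k, (k <= l)%N -> U k s = u (inord k)].
Proof.
apply/seteqP; split => s /=.
  by move=> <- k kl; rewrite ffunE inordK.
move=> H; apply/ffunP => k; rewrite ffunE H; last by rewrite -ltnS.
by rewrite inord_val.
Qed.

Lemma measurable_chain_prefix l u : measurable [set s | chain_prefix l s = u].
Proof.
rewrite (_ : [set s | _] = \bigcap_(k in [set k | (k <= l)%N])
    [set s | U k s = u (inord k)]).
  by apply: bigcap_measurable => [|k _]; [exists 0%N|exact: mU].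
by rewrite chain_prefixE.
Qed.

Lemma measurable_chain_prefix_step l ux :
  measurable [set s | (chain_prefix l s, U l.+1 s) = ux].
Proof.
rewrite (_ : [set s | _] = [set s | chain_prefix l s = ux.1] `&`
   [set s | U l.+1 s = ux.2]).
  by apply: measurableI => //; exact: measurable_chain_prefix.
by case: ux => u y /=; apply/seteqP; split => s /=; [case=> -> ->|case=> -> ->].
Qed.

(** The Markov property is given on single paths. Prefixes take finitely many values, so both
    integrals are finite sums over prefixes, to which it applies term by term. *)
Lemma markov_step l (h : {ffun 'I_l.+1 -> E} -> E -> R) :
    (forall u y, 0 <= h u y) ->
  (\int[Q]_s (h (chain_prefix l s) (U l.+1 s))%:E =
   \int[Q]_s (kernel_op p (h (chain_prefix l s)) (U l s))%:E)%E.
Proof.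
move=> h0.
rewrite (integral_finite_valued Q (@measurable_chain_prefix_step l)
  (F := fun ux => h ux.1 ux.2)) //.
have -> : (fun s => (kernel_op p (h (chain_prefix l s)) (U l s))%:E) =
    (fun s => ((fun u => kernel_op p (h u) (u ord_max)) (chain_prefix l s))%:E).
  by apply/funext => s /=; rewrite ffunE.
rewrite (integral_finite_valued Q (@measurable_chain_prefix l)
  (F := fun u => kernel_op p (h u) (u ord_max))); last first.
  by move=> u; apply: sumr_ge0 => y _; rewrite mulr_ge0.
congr (_%:E).
transitivity (\sum_u \sum_y h u y *
  fine (Q [set s | (chain_prefix l s, U l.+1 s) = (u, y)])).
  by rewrite pair_bigA; apply: eq_bigr => -[].
apply: eq_bigr => u _; rewrite /kernel_op mulr_suml; apply: eq_bigr => y _.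
have [_ _ /(_ l (fun k => u (inord k)) y) H] := mcU.
rewrite (_ : [set s | (chain_prefix l s, U l.+1 s) = (u, y)] =
   [set s | (forall k, (k <= l)%N -> U k s = u (inord k)) /\ U l.+1 s = y]).
  rewrite {}H chain_prefixE fineM ?fin_num_measure //.
    rewrite /= (_ : inord l = ord_max); first by ring.
    by apply: val_inj; rewrite /= inordK.
  by rewrite -chain_prefixE; exact: measurable_chain_prefix.
have := chain_prefixE u => /seteqP[e1 e2].
apply/seteqP; split => s /=.
  by case=> su sy; split => //; exact: e1.
by case=> su sy; congr (_, _) => //; exact: e2.
Qed.

Lemma integral_initial (g : E -> R) : (forall y, 0 <= g y) ->
  (\int[Q]_s (g (U 0%N s))%:E = (g x)%:E)%E.
Proof.
move=> g0; have [_ U0 _] := mcU.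
rewrite (integral_finite_valued Q (mU 0)) // (bigD1 x) //= U0 mulr1 big1 ?addr0 //.
move=> y yx; suff -> : Q [set s | U 0%N s = y] = 0%E by rewrite mulr0.
apply/eqP; rewrite -measure_le0 //.
have <- : Q (~` [set s | U 0%N s = x]) = 0%E.
  by rewrite probability_setC // U0 subee.
apply: le_measure; rewrite ?inE //; first exact: measurableC.
by move=> s /= -> xy; move: yx; rewrite xy eqxx.
Qed.

Lemma integral_chain l (g : E -> R) : (forall y, 0 <= g y) ->
  (\int[Q]_s (g (U l s))%:E = (iter l (kernel_op p) g x)%:E)%E.
Proof.
elim: l g => [|l IH] g g0; first exact: integral_initial.
rewrite (@markov_step l (fun _ y => g y)) // iterSr IH // => y.
by apply: sumr_ge0 => z _; rewrite mulr_ge0.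
Qed.

End MarkovLaw.

Lemma step_lawE {R : realType} {d} {S : measurableType d} {E : finType}
    (Q : E -> probability S R) (p : E -> E -> R) (U : nat -> S -> E)
    (x : E) l (B : {set E}) :
    (forall y z, 0 <= p y z) -> markov_chain (Q x) p x U ->
  step_law Q U x l B = iter l (kernel_op p) (fun y => (y \in B)%:R) x.
Proof.
move=> p0 mc; rewrite /step_law.
have mB : measurable [set s | U l s \in B].
  rewrite (_ : [set s | _] = \bigcup_(y in [set` B]) [set s | U l s = y]).
    by apply: fin_bigcup_measurable => // y _; case: mc.
  by apply/seteqP; split => s /=; [move=> sB; exists (U l s)|case=> y /= yB ->].
rewrite -[X in Q x X]setIT -integral_indic //.
transitivity (fine (\int[Q x]_s ((U l s \in B)%:R)%:E)%E).
  congr (fine _); apply: eq_integral => s _; rewrite indicE.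
  by case: (boolP (U l s \in B)) => sB; [rewrite mem_set|rewrite memNset //; exact/negP].
by rewrite (integral_chain p0 mc l (g := fun y => (y \in B)%:R)).
Qed.

Section ConstantIntegrals.
Context {R : realType} {d : measure_display} {S : measurableType d}.
Variables (Q : probability S R) (N : set S).
Variables (f_ : nat -> S -> R) (f : S -> R) (c : R).
Hypothesis mN : measurable N.
Hypothesis QN0 : Q N = 0%E.
Hypothesis mf_ : forall l, measurable_fun setT (f_ l).
Hypothesis mf : measurable_fun setT f.
Hypothesis f_ge0 : forall l s, 0 <= f_ l s.
Hypothesis f0 : forall s, 0 <= f s.
Hypothesis f_f : forall s, ~ N s -> \forall l \near \oo, f_ l s = f s.
Hypothesis If_ : forall l, (\int[Q]_s (f_ l s)%:E = c%:E)%E.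

Let f_cvg s : ~ N s -> ((f_ l s)%:E @[l --> \oo] --> (f s)%:E)%E.
Proof.
move=> /f_f fs; apply: cvg_near_cst; near=> l; congr (_%:E).
by apply/eqP; near: l; apply: filterS fs => l ->.
Unshelve. all: by end_near. Qed.

(** Fatou's lemma asks for no dominating function. It will give the integrability of the squared
    deviation of the hitting time, which then provides the domination for the equality that
    follows. *)
Lemma fatou_eventually_constant : (\int[Q]_s (f s)%:E <= c%:E)%E.
Proof.
rewrite (@ge0_negligible_integral _ _ _ Q setT N) //; last 2 first.
- exact/measurable_EFinP.
- by move=> s _; rewrite lee_fin.
rewrite setTD.
have mCN : measurable (~` N) by exact: measurableC.
have mEf_ l : measurable_fun (~` N) (fun s => (f_ l s)%:E).
  by apply: measurable_funTS; exact/measurable_EFinP.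
rewrite (eq_integral (fun s => limn_einf (fun l => (f_ l s)%:E))); last first.
  by move=> s /set_mem /= Ns; have [-> _] := cvg_limn_einf_sup (f_cvg Ns).
apply: le_trans (fatou Q mCN mEf_ _) _.
  by move=> l s _; rewrite lee_fin.
rewrite [leLHS](_ : _ = limn_einf (fun=> c%:E)).
  by have [-> _] := cvg_limn_einf_sup (cvg_cst c%:E : (fun=> c%:E) @ \oo --> _).
congr (limn_einf _); apply/funext => l.
rewrite -(If_ l) (@ge0_negligible_integral _ _ _ Q setT N) ?setTD //.
- exact/measurable_EFinP.
- by move=> s _; rewrite lee_fin.
Qed.

Lemma integral_eventually_constant (g : S -> R) :
    Q.-integrable setT (EFin \o g) -> (forall l s, ~ N s -> f_ l s <= g s) ->
  (\int[Q]_s (f s)%:E = c%:E)%E.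
Proof.
move=> ig fg.
have mEf_ l : measurable_fun setT (fun s => (f_ l s)%:E) by exact/measurable_EFinP.
have mEf : measurable_fun setT (fun s => (f s)%:E) by exact/measurable_EFinP.
have cvgf : {ae Q, forall s, setT s -> (f_ l s)%:E @[l --> \oo] --> (f s)%:E}%E.
  exists N; split => // s /= Hs; apply: contrapT => Ns; apply: Hs => _.
  exact: f_cvg.
have lef : {ae Q, forall s l, setT s -> `|(f_ l s)%:E| <= (EFin \o g) s}%E.
  exists N; split => // s /= Hs; apply: contrapT => Ns; apply: Hs => l _.
  by rewrite lee_fin ger0_norm // fg.
have [_ _ H] := dominated_convergence measurableT mEf_ mEf cvgf ig lef.
move: H; rewrite (_ : [sequence _]_n = fun=> c%:E); last exact/funext.
move=> H; apply: esym; apply: cvg_unique H => //; exact: cvg_cst.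
Qed.

End ConstantIntegrals.

(** * Optional stopping at the hitting time of a state *)

Section StoppedChain.
Context {R : realType} {d : measure_display} {S : measurableType d} {E : finType}.
Variables (U : nat -> S -> E) (b : E).

(** The minimum of l and the hitting time of b: [find] returns the length l if b does not occur
    before time l. *)
Definition stop_time l s := find (fun k => U k s == b) (iota 0 l).

Lemma stop_timeS l s : stop_time l.+1 s =
  if has (fun k => U k s == b) (iota 0 l.+1) then stop_time l s else l.+1.
Proof.
rewrite /stop_time -addn1 iotaD find_cat has_cat size_iota /= add0n orbF.
by case: ifP => //= /negbT h; case: eqP => _; rewrite ?addn0 ?addn1 // hasNfind ?size_iota.
Qed.

Lemma stop_time_le l s : (stop_time l s <= l)%N.
Proof. by have := find_size (fun k => U k s == b) (iota 0 l); rewrite size_iota. Qed.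

Lemma stop_time_never l s : (forall k, U k s <> b) -> stop_time l s = l.
Proof.
move=> H; rewrite /stop_time hasNfind ?size_iota //.
by apply/hasPn => k _; apply/eqP/H.
Qed.

Lemma stop_time_first j l s : U j s = b -> (forall k, (k < j)%N -> U k s <> b) ->
  stop_time l s = minn j l.
Proof.
move=> Uj Uk; elim: l => [|l IH]; first by rewrite minn0.
rewrite stop_timeS; case: ifPn => [/hasP[k]|/hasPn H].
  rewrite mem_iota add0n => /= kl /eqP Ukb; rewrite IH.
  have jk : (j <= k)%N by rewrite leqNgt; apply/negP => /Uk.
  by rewrite !(minn_idPl _) //; lia.
apply: esym; apply/minn_idPr; rewrite leqNgt; apply/negP => jl.
by have := H j; rewrite mem_iota add0n jl Uj eqxx => /(_ isT).
Qed.

Lemma hitting_time_first j s : U j s = b -> (forall k, (k < j)%N -> U k s <> b) ->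
  hitting_time U b s = (j%:R : R)%:E.
Proof.
move=> Uj Uk; apply/eqP; rewrite eq_le; apply/andP; split.
  by apply: ge_ereal_inf; exists j%:R%:E => //; exists j.
apply: le_ereal_inf_tmp => _ [k /= Ukb <-]; rewrite lee_fin ler_nat leqNgt.
by apply/negP => /Uk.
Qed.

Lemma hitting_time_never s : (forall k, U k s <> b) ->
  hitting_time U b s = (+oo : \bar R)%E.
Proof.
move=> H; rewrite /hitting_time (_ : [set l | _] = set0) ?image_set0 ?ereal_inf0 //.
by apply/seteqP; split => // l /= /H.
Qed.

Lemma first_hit s : (exists k, U k s = b) ->
  exists2 j, U j s = b & forall k, (k < j)%N -> U k s <> b.
Proof.
move=> [k Uk]; have ex : exists k, U k s == b by exists k; apply/eqP.
have [j /eqP Uj jmin] := ex_minnP ex; exists j => // i ij /eqP /jmin; lia.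
Qed.

End StoppedChain.

Section HittingTimeMoments.
Context {R : realType} {d : measure_display} {S : measurableType d} {E : finType}.
Variables (Q : probability S R) (p : E -> E -> R) (x : E) (U : nat -> S -> E).
Variable b : E.
Hypothesis p_ge0 : forall y z, 0 <= p y z.
Hypothesis p_sum : forall y, \sum_z p y z = 1.
Hypothesis mcU : markov_chain Q p x U.

Let mU l y : measurable [set s | U l s = y].
Proof. by case: mcU. Qed.

Definition stopped (q : E -> nat -> R) l s :=
  q (U (stop_time U b l s) s) (stop_time U b l s).

Let tau l (u : {ffun 'I_l.+1 -> E}) := find (fun k => u (inord k) == b) (iota 0 l).

Let tauE l s : tau (chain_prefix U l s) = stop_time U b l s.
Proof.
apply: eq_in_find => k; rewrite mem_iota add0n => /= kl.
by rewrite ffunE inordK // ltnW.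
Qed.

Let stoppedE q l s :
  stopped q l s = (fun u : {ffun 'I_l.+1 -> E} => q (u (inord (tau u))) (tau u)) (chain_prefix U l s).
Proof. by rewrite /= tauE ffunE inordK // ltnS stop_time_le. Qed.

Lemma measurable_stopped q l : measurable_fun setT (stopped q l).
Proof.
rewrite (_ : stopped q l = (fun u : {ffun 'I_l.+1 -> E} => q (u (inord (tau u))) (tau u)) \o chain_prefix U l).
  by apply: measurable_finite_valued => u; exact: (measurable_chain_prefix mcU).
by apply/funext => s; exact: stoppedE.
Qed.

(** The stopped process is a martingale: whether it is frozen at step l + 1 can be read off the
    states up to time l, which are the argument of [markov_step]. *)
Lemma integral_stopped q l : (forall y k, 0 <= q y k) ->
    (forall y k, y != b -> kernel_op p (fun z => q z k.+1) y = q y k) ->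
  (\int[Q]_s (stopped q l s)%:E = (q x 0%N)%:E)%E.
Proof.
move=> q0 qb; elim: l => [|l IH].
  by rewrite -(integral_initial mcU (g := fun y => q y 0%N)).
rewrite -IH.
pose hit (u : {ffun 'I_l.+1 -> E}) := has (fun k => u (inord k) == b) (iota 0 l.+1).
pose h (u : {ffun 'I_l.+1 -> E}) y :=
  if hit u then q (u (inord (tau u))) (tau u) else q y l.+1.
have hitE s : hit (chain_prefix U l s) = has (fun k => U k s == b) (iota 0 l.+1).
  apply: eq_in_has => k; rewrite mem_iota add0n => /= kl.
  by rewrite ffunE inordK.
transitivity (\int[Q]_s (h (chain_prefix U l s) (U l.+1 s))%:E)%E.
  apply: eq_integral => s _; congr (_%:E).
  rewrite /h hitE {1}/stopped stop_timeS; case: ifP => // _.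
  by rewrite tauE ffunE inordK // ltnS stop_time_le.
rewrite (markov_step p_ge0 mcU); last by move=> u y; rewrite /h; case: ifP.
apply: eq_integral => s _; congr (_%:E).
rewrite /h hitE; case: (boolP (has _ _)) => [_|/hasPn nh].
  by rewrite (kernel_op_cst p_sum) (stoppedE q l s).
have Ub k : (k <= l)%N -> U k s != b by move=> kl; apply: nh; rewrite mem_iota.
rewrite qb ?Ub // /stopped (_ : stop_time U b l s = l) //.
rewrite /stop_time hasNfind ?size_iota //.
by apply/hasPn => k; rewrite mem_iota add0n => /= kl; rewrite Ub // ltnW.
Qed.

Let never := [set s | forall k, U k s <> b].

Let mnever : measurable never.
Proof.
rewrite (_ : never = \bigcap_k ~` [set s | U k s = b]).
  by apply: bigcapT_measurable => k; exact: measurableC.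
by apply/seteqP; split => s /= H k; [move=> _; exact: H|exact: H k I].
Qed.

Let time s : R := fine (hitting_time U b s : \bar R).

Lemma measurable_hitting_time : measurable_fun setT time.
Proof.
(* The value 0 at k = l makes the approximations vanish on paths that never hit b, in agreement with
   [fine +oo = 0]. *)
pose q l (_ : E) k : R := if (k < l)%N then k%:R else 0.
apply: (@measurable_fun_cvg _ _ _ _ (fun l => stopped (q l) l)).
  by move=> l; exact: measurable_stopped.
move=> s _; have [/first_hit[j Uj Uk]|Hs] := pselect (exists k, U k s = b).
  apply: cvg_near_cst; exists j.+1 => // l /= jl; apply/eqP.
  rewrite /stopped (stop_time_first _ Uj Uk) (minn_idPl _) ?(ltnW jl) // /q jl.
  by rewrite /time (hitting_time_first Uj Uk).
have Hs' k : U k s <> b by move=> Uk; apply: Hs; exists k.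
apply: cvg_near_cst; apply: nearW => l; apply/eqP.
rewrite /stopped stop_time_never // /q ltnn /time.
by rewrite hitting_time_never.
Qed.

Variables m v : E -> R.
Hypothesis m_ge0 : forall y, 0 <= m y.
Hypothesis v_ge0 : forall y, 0 <= v y.
Hypothesis mb : m b = 0.
Hypothesis vb : v b = 0.
Hypothesis m_step : forall y s, y != b ->
  kernel_op p (fun z => s + 1 + m z) y = s + m y.
Hypothesis v_step : forall y a s, y != b ->
  kernel_op p (fun z => v z + (s + 1 + m z - a) ^+ 2) y = v y + (s + m y - a) ^+ 2.

Let M := m x.
Let q1 y (k : nat) : R := k%:R + m y.
(** Centred at the mean from the starting point, so that the initial value is [v x] alone. *)
Let q2 y (k : nat) : R := v y + (k%:R + m y - M) ^+ 2.

Let q1_ge0 y k : 0 <= q1 y k. Proof. by rewrite addr_ge0. Qed.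
Let q2_ge0 y k : 0 <= q2 y k. Proof. by rewrite addr_ge0 // sqr_ge0. Qed.

Let I1 l : (\int[Q]_s (stopped q1 l s)%:E = M%:E)%E.
Proof.
rewrite integral_stopped //; first by rewrite /q1 add0r.
move=> y k yb; rewrite /q1 -m_step //; apply: eq_bigr => z _.
by rewrite -natr1.
Qed.

Let I2 l : (\int[Q]_s (stopped q2 l s)%:E = (v x)%:E)%E.
Proof.
rewrite integral_stopped //; first by rewrite /q2 add0r subrr expr0n addr0.
move=> y k yb; rewrite /q2 -v_step //; apply: eq_bigr => z _.
by rewrite -natr1.
Qed.

(** On this event the stopped [q1] is at least l, while its integral is M for every l; hence l times
    the probability never exceeds M. *)
Let never0 : Q never = 0%E.
Proof.
apply/eqP; rewrite -measure_le0 leNgt; apply/negP => Q0.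
have Qfin : Q never \is a fin_num by exact: fin_num_measure.
have bound l : l%:R * fine (Q never) <= M.
  rewrite -lee_fin EFinM fineK // -(I1 l) -[X in Q X]setIT -integral_indic //.
  rewrite -ge0_integralZl_EFin //; last by apply/measurable_EFinP; exact: measurable_indic.
  apply: ge0_le_integral => [|s _|||s _].
  - exact: measurableT.
  - by rewrite -EFinM lee_fin mulr_ge0.
  - by apply: measurable_funeM; apply/measurable_EFinP; exact: measurable_indic.
  - by apply/measurable_EFinP; exact: measurable_stopped.
  rewrite -EFinM lee_fin indicE.
  have [/set_mem /= Hs|_] := boolP (s \in never); last by rewrite mulr0 q1_ge0.
  by rewrite mulr1 /stopped stop_time_never // /q1 lerDl.
have q0 : 0 < fine (Q never) by rewrite fine_gt0 // Q0 ltey_eq Qfin.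
have := bound (Num.truncn (M / fine (Q never))).+1.
have := truncnS_gt (M / fine (Q never)); rewrite ltr_pdivrMr // => H1 H2.
by have := lt_le_trans H1 H2; rewrite ltxx.
Qed.

Let stopped_near q s : ~ never s ->
  exists2 j : nat, time s = j%:R &
    (\forall l \near \oo, stopped q l s = q b j) /\
    forall l, (stop_time U b l s <= j)%N.
Proof.
move=> Hs; have /first_hit[j Uj Uk] : exists k, U k s = b.
  by apply: contrapT => H; apply: Hs => k Uk; apply: H; exists k.
exists j; first by rewrite /time (hitting_time_first Uj Uk).
split; last by move=> l; rewrite (stop_time_first _ Uj Uk) geq_minl.
exists j => // l /= jl; rewrite /stopped (stop_time_first _ Uj Uk).
by rewrite (minn_idPl _) // Uj.
Qed.

Let mtime := measurable_hitting_time.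
Let mdev : measurable_fun setT (fun s => (time s - M) ^+ 2).
Proof. by apply: measurable_funX; apply: measurable_funB => //; exact: measurable_cst. Qed.

Let dev_near s : ~ never s -> \forall l \near \oo, stopped q2 l s = (time s - M) ^+ 2.
Proof.
move=> /(stopped_near q2)[j -> [H _]]; apply: filterS H => l ->.
by rewrite /q2 vb mb addr0 add0r.
Qed.

Let integrable_dev : Q.-integrable setT (EFin \o (fun s => (time s - M) ^+ 2)).
Proof.
apply/integrableP; split; first exact/measurable_EFinP.
apply: le_lt_trans (ltry (v x)).
under eq_integral do rewrite /= ger0_norm ?sqr_ge0 //.
apply: (@fatou_eventually_constant _ _ _ Q never (stopped q2)) => //.
- by move=> l; exact: measurable_stopped.
- by move=> l s; exact: q2_ge0.
- by move=> s; rewrite sqr_ge0.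
Qed.

Let m_max := \sum_y m y.
Let v_max := \sum_y v y.
Let m_le y : m y <= m_max.
Proof. by rewrite /m_max (bigD1 y) //= lerDl sumr_ge0. Qed.
Let v_le y : v y <= v_max.
Proof. by rewrite /v_max (bigD1 y) //= lerDl sumr_ge0. Qed.

Let integrable_affine_dev (c c' : R) :
  Q.-integrable setT (EFin \o (fun s => c + c' * (time s - M) ^+ 2)).
Proof.
rewrite (_ : EFin \o _ = (EFin \o cst c) \+
  (fun s : S => (c'%:E * ((time s - M) ^+ 2)%R%:E)%E)) //.
apply: integrableD => //; last exact: integrableZl.
exact: finite_measure_integrable_cst.
Qed.

Lemma hitting_time_mean : ('E_Q[time] = M%:E)%E.
Proof.
rewrite unlock.
(* The hitting time j is dominated through its own squared deviation: j <= 1 + M + (j - M)^2. *)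
apply: (integral_eventually_constant mnever never0 (f_ := stopped q1) _ _ _ _ _
  (g := fun s => (1 + M + m_max) + 1 * (time s - M) ^+ 2)) => //.
- by move=> l; exact: measurable_stopped.
- by move=> l s; exact: q1_ge0.
- move=> s /(stopped_near q1)[j -> [H _]]; apply: filterS H => l ->.
  by rewrite /q1 mb addr0.
- move=> l s /(stopped_near q1)[j -> [_ H]]; rewrite /stopped /q1.
  have := H l; rewrite -(ler_nat R) => H1.
  have := m_le (U (stop_time U b l s) s); have := sqr_ge0 (j%:R - M - 1 : R).
  have := sqr_ge0 (j%:R - M : R); nra.
Qed.

Lemma hitting_time_variance : ('V_Q[time] = (v x)%:E)%E.
Proof.
rewrite /variance unlock hitting_time_mean /= unlock.
transitivity (\int[Q]_s ((time s - M) ^+ 2)%:E)%E.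
  by apply: eq_integral => s _; rewrite /= expr2.
apply: (integral_eventually_constant mnever never0 (f_ := stopped q2) _ _ _ _ _
  (g := fun s => (v_max + 2 * (M + m_max) ^+ 2 + 4 * M ^+ 2) + 4 * (time s - M) ^+ 2)) => //.
- by move=> l; exact: measurable_stopped.
- by move=> l s; exact: q2_ge0.
- move=> l s /(stopped_near q2)[j -> [_ H]]; rewrite /stopped /q2.
  have := H l; rewrite -(ler_nat R) => H1.
  set y := U _ s; have my := m_le y; have vy := v_le y; have m0 := m_ge0 y.
  have M0 : 0 <= M by exact: m_ge0.
  set t := (stop_time U b l s)%:R in H1 *.
  have t0 : 0 <= t :> R by [].
  have j0 : 0 <= j%:R :> R by [].
  have E1 : (t + m y - M) ^+ 2 <= 2 * (M + m_max) ^+ 2 + 2 * j%:R ^+ 2.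
    have [h|h] := leP (t + m y) M.
      have : (M - (t + m y)) ^+ 2 <= (M + m_max) ^+ 2.
        by rewrite lerXn2r ?nnegrE; lra.
      by have := sqr_ge0 (j%:R : R); have := sqr_ge0 (M + m_max); nra.
    have : (t + m y - M) ^+ 2 <= (j%:R + (M + m_max)) ^+ 2.
      by rewrite lerXn2r ?nnegrE; lra.
    by have := sqr_ge0 (j%:R - (M + m_max)); nra.
  have : j%:R ^+ 2 <= 2 * (j%:R - M) ^+ 2 + 2 * M ^+ 2.
    by have := sqr_ge0 (j%:R - 2 * M); nra.
  lra.
Qed.

End HittingTimeMoments.

(** * Independence *)

Section IndependentFactor.
Context {R : realType} {d : measure_display} {T : measurableType d}.
Variables (P : probability T R) (X : {RV P >-> R}).
Import HBNNSimple.

Let mX : measurable_fun setT X.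
Proof. by []. Qed.

Let mpreX C : measurable C -> measurable (X @^-1` C).
Proof. by move=> mC; rewrite -[X in measurable X]setTI; exact: mX. Qed.

Lemma integral_factor_simple (H : T -> R) (c : R) (h : {nnsfun R >-> R}) :
    measurable_fun setT H -> (forall t, 0 <= H t) ->
    (forall C, measurable C ->
      (\int[P]_t (H t * \1_(X @^-1` C) t)%:E = c%:E * P (X @^-1` C))%E) ->
  (\int[P]_t (H t * h (X t))%:E =
   \sum_(y \in range h) (y%:E * (c%:E * P (X @^-1` (h @^-1` [set y])))))%E.
Proof.
move=> mH H0 HC.
have mI y : measurable (X @^-1` (h @^-1` [set y])) by exact: mpreX.
transitivity (\int[P]_t \sum_(y \in range h)
    ((H t)%:E * (y%:E * (\1_(h @^-1` [set y]) (X t))%:E)))%E.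
  apply: eq_integral => t _; rewrite (fimfunE h (X t)) EFinM -fsumEFin //.
  rewrite ge0_mule_fsumr; first by [].
  by move=> y; rewrite EFinM; exact: nnfun_muleindic_ge0.
rewrite ge0_integral_fsum //; last 2 first.
- move=> y; rewrite (_ : (fun t => _) =
    (fun t => (y%:E * (H t * \1_(X @^-1` (h @^-1` [set y])) t)%:E)%E)).
    apply: measurable_funeM; apply/measurable_EFinP.
    by apply: measurable_funM => //; exact: measurable_indic.
  by apply/funext => t; rewrite EFinM muleCA.
- by move=> y t _; rewrite mule_ge0 ?lee_fin //; exact: nnfun_muleindic_ge0.
apply: eq_fsbigr => y /set_mem [z _ hz].
rewrite -HC; last exact: measurable_funPTI.
rewrite -ge0_integralZl_EFin //.
- by apply: eq_integral => t _; rewrite EFinM muleCA.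
- by move=> t _; rewrite lee_fin mulr_ge0.
- apply/measurable_EFinP; apply: measurable_funM => //; exact: measurable_indic.
- by rewrite -hz fun_ge0.
Qed.

(** Linearity extends the factorization from indicators to simple functions, and monotone
    convergence, used both with weight H and with weight 1, extends it to f. *)
Lemma ge0_integral_factor (H : T -> R) (c : R) (f : R -> R) :
    measurable_fun setT H -> (forall t, 0 <= H t) -> 0 <= c ->
    (forall C, measurable C ->
      (\int[P]_t (H t * \1_(X @^-1` C) t)%:E = c%:E * P (X @^-1` C))%E) ->
    measurable_fun setT f -> (forall y, 0 <= f y) ->
  (\int[P]_t (H t * f (X t))%:E = c%:E * \int[P]_t (f (X t))%:E)%E.
Proof.
move=> mH H0 c0 HC mf f0.
have simple (h : {nnsfun R >-> R}) :
    (\int[P]_t (H t * h (X t))%:E = c%:E * \int[P]_t (h (X t))%:E)%E.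
  rewrite (integral_factor_simple _ mH H0 HC).
  transitivity (c%:E * \int[P]_t (1 * h (X t))%:E)%E; last first.
    by congr (_ * _)%E; apply: eq_integral => t _; rewrite mul1r.
  (* The weight 1 brings the unweighted integral into the same form. *)
  rewrite (@integral_factor_simple (fun=> 1) 1) //; last first.
    move=> C mC; rewrite mul1e; under eq_integral do rewrite mul1r.
    by rewrite integral_indic ?setIT //; exact: mpreX.
  rewrite ge0_mule_fsumr; first by apply: eq_fsbigr => y _; rewrite muleCA mul1e.
  move=> y; rewrite mul1e; exact: (nnsfun_mulemu_ge0 (distribution P X)).
have mEf : measurable_fun setT (EFin \o f) by exact/measurable_EFinP.
pose g := nnsfun_approx measurableT mEf.
have g_cvg y : (EFin \o g^~ y) @ \oo --> (EFin \o f) y.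
  by apply: cvg_nnsfun_approx => // z _; rewrite lee_fin.
have g_nd y m n : (m <= n)%N -> g m y <= g n y.
  by move=> mn; have /lefP := nd_nnsfun_approx measurableT mEf mn; exact.
have lim (K : T -> R) : measurable_fun setT K -> (forall t, 0 <= K t) ->
    ((\int[P]_t (K t * g n (X t))%:E)%E @[n --> \oo] -->
     (\int[P]_t (K t * f (X t))%:E)%E).
  move=> mK K0.
  have -> : (\int[P]_t (K t * f (X t))%:E)%E =
      (\int[P]_t limn (fun n => (K t * g n (X t))%:E))%E.
    apply: eq_integral => t _; apply/esym/cvg_lim => //.
    under eq_fun do rewrite EFinM.
    by rewrite EFinM; apply: cvgeZl => //; exact: g_cvg.
  apply: cvg_monotone_convergence => //.
  - move=> n; apply/measurable_EFinP; apply: measurable_funM => //.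
    by apply: measurableT_comp.
  - by move=> n t _; rewrite lee_fin mulr_ge0.
  - by move=> t _ m n mn; rewrite lee_fin ler_wpM2l // g_nd.
have l1 := lim H mH H0.
have l2 : ((c%:E * \int[P]_t (g n (X t))%:E)%E @[n --> \oo] -->
     (c%:E * \int[P]_t (f (X t))%:E)%E).
  apply: cvgeZl => //.
  have one (k : R -> R) :
      (\int[P]_t (k (X t))%:E = \int[P]_t (1 * k (X t))%:E)%E.
    by apply: eq_integral => t _; rewrite mul1r.
  rewrite one (_ : (fun n => _) = fun n => (\int[P]_t (1 * g n (X t))%:E)%E).
    by apply: (lim (fun=> 1)) => //.
  by apply/funext => n; exact: one.
apply: cvg_unique l1 _ => //.
by rewrite (_ : (fun n => _) = fun n => (c%:E * \int[P]_t (g n (X t))%:E)%E) //;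
  apply/funext => n; exact: simple.
Qed.
End IndependentFactor.

Section IndependentOfTail.
Context {R : realType} {d : measure_display} {T : measurableType d}.
Variables (P : probability T R) (omega : int -> {RV P >-> R}).
Hypothesis omega_iid : iid omega.

Definition cylinder (s : seq int) (B : int -> set R) : set T :=
  \bigcap_(k in [set` s]) (omega k @^-1` B k).

Lemma measurable_cylinder s B : (forall k, measurable (B k)) ->
  measurable (cylinder s B).
Proof.
move=> mB; rewrite /cylinder bigcap_seq; apply: big_ind => //.
- exact: measurableI.
- by move=> k _; exact: measurable_funPTI.
Qed.

Lemma cylinder_cons k s B : cylinder (k :: s) B = omega k @^-1` B k `&` cylinder s B.
Proof. by rewrite /cylinder !bigcap_seq big_cons. Qed.

Lemma eq_cylinder s B B' : {in s, B =1 B'} -> cylinder s B = cylinder s B'.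
Proof.
by move=> BB'; apply/seteqP; split => t tB k /= ks; have := tB k ks; rewrite /= BB'.
Qed.

(* G has mean g and is independent of (omega k, k >= i) *)
Definition mean_indep (i : nat) (G : T -> R) (g : R) : Prop :=
  [/\ measurable_fun setT G, forall t, 0 <= G t &
    forall s B, uniq s -> all (fun k => i%:Z <= k) s -> (forall k, measurable (B k)) ->
    (\int[P]_t (G t * \1_(cylinder s B) t)%:E = g%:E * P (cylinder s B))%E].

Lemma mean_indepE i G g : mean_indep i G g -> (\int[P]_t (G t)%:E = g%:E)%E.
Proof.
move=> [_ _ /(_ [::] (fun=> setT))]; rewrite /cylinder set_nil bigcap_set0.
rewrite probability_setT mule1 => <- //.
by apply: eq_integral => t _; rewrite indicT mulr1.
Qed.

Lemma mean_indep_ge0 i G g : mean_indep i G g -> 0 <= g.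
Proof.
move=> H; rewrite -lee_fin -(mean_indepE H).
by case: H => _ G0 _; apply: integral_ge0 => t _; rewrite lee_fin.
Qed.

Lemma mean_indep_cst i (c : R) : 0 <= c -> mean_indep i (fun=> c) c.
Proof.
move=> c0; split => // s B _ _ mB; have mC := measurable_cylinder s mB.
under eq_integral do rewrite EFinM.
rewrite ge0_integralZl_EFin //; last by apply/measurable_EFinP; exact: measurable_indic.
by rewrite integral_indic // setIT.
Qed.

Lemma mean_indepD i G g G' g' : mean_indep i G g -> mean_indep i G' g' ->
  mean_indep i (fun t => G t + G' t) (g + g').
Proof.
move=> HG HG'; have g0 := mean_indep_ge0 HG; have g'0 := mean_indep_ge0 HG'.
case: HG HG' => mG G0 H [mG' G'0 H']; split => [|t|s B us si mB].
- exact: measurable_funD.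
- by rewrite addr_ge0.
have mC := measurable_cylinder s mB.
under eq_integral do rewrite mulrDl EFinD.
rewrite ge0_integralD //.
- by rewrite H // H' // EFinD ge0_muleDl.
- by move=> t _; rewrite lee_fin mulr_ge0.
- by apply/measurable_EFinP; apply: measurable_funM => //; exact: measurable_indic.
- by move=> t _; rewrite lee_fin mulr_ge0.
- by apply/measurable_EFinP; apply: measurable_funM => //; exact: measurable_indic.
Qed.

Lemma mean_indepZ i G g (c : R) : 0 <= c -> mean_indep i G g ->
  mean_indep i (fun t => c * G t) (c * g).
Proof.
move=> c0 [mG G0 H]; split => [|t|s B us si mB].
- by apply: measurable_funM => //; exact: measurable_cst.
- by rewrite mulr_ge0.
have mC := measurable_cylinder s mB.
under eq_integral do rewrite -mulrA EFinM.
rewrite ge0_integralZl_EFin //.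
- by rewrite H // EFinM muleA.
- by move=> t _; rewrite lee_fin mulr_ge0.
- by apply/measurable_EFinP; apply: measurable_funM => //; exact: measurable_indic.
Qed.

(** Mutual independence enters only here. A cylinder over indices beyond i, intersected with an
    event on [omega i], is again a cylinder over indices from i on; the hypothesis on G covers it,
    and its probability factorizes. *)
Lemma mean_indepM i G g (f : R -> R) (e : R) :
    mean_indep i G g -> measurable_fun setT f -> (forall y, 0 <= f y) ->
    (\int[P]_t (f (omega i t))%:E = e%:E)%E ->
  mean_indep i.+1 (fun t => G t * f (omega i t)) (g * e).
Proof.
move=> HG mf f0 fe; have g0 := mean_indep_ge0 HG.
case: HG => mG G0 H; split => [|t|s B us si mB].
- by apply: measurable_funM => //; exact: measurableT_comp.
- by rewrite mulr_ge0.
have mC := measurable_cylinder s mB.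
have QC : P (cylinder s B) \is a fin_num by exact: fin_num_measure.
transitivity (\int[P]_t (G t * \1_(cylinder s B) t * f (omega i t))%:E)%E.
  by apply: eq_integral => t _; rewrite mulrAC.
rewrite (@ge0_integral_factor _ _ _ _ _ _ (g * fine (P (cylinder s B)))) //.
- by rewrite fe !EFinM fineK // muleAC.
- by apply: measurable_funM => //; exact: measurable_indic.
- by move=> t; rewrite mulr_ge0.
- by rewrite mulr_ge0 // fine_ge0.
move=> C mC'.
(* Since i is not in s, overwriting the constraint at i does not change the cylinder over s. *)
pose B' k := if k == i%:Z then C else B k.
have is_ : i%:Z \notin s.
  by apply/negP => /(allP si); rewrite lez_nat ltnn.
have BB' : cylinder s B = cylinder s B'.
  by apply: eq_cylinder => k ks; rewrite /B' ifN //; apply: contraNneq is_ => <-.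
have cyl : cylinder (i%:Z :: s) B' = omega i @^-1` C `&` cylinder s B.
  by rewrite cylinder_cons {1}/B' eqxx -BB'.
have mB' k : measurable (B' k) by rewrite /B'; case: ifP.
have ui : uniq (i%:Z :: s) by rewrite /= is_.
have si' : all (fun k => i%:Z <= k) (i%:Z :: s).
  by rewrite /= lexx /=; apply: sub_all si => k; apply: le_trans; rewrite lez_nat.
transitivity (\int[P]_t (G t * \1_(cylinder (i%:Z :: s) B') t)%:E)%E.
  apply: eq_integral => t _; rewrite cyl indicI /= -mulrA.
  by congr (_ * _)%:E; rewrite mulrC.
rewrite H // EFinM -muleA; congr (_ * _)%E; rewrite fineK //.
have [ind _] := omega_iid.
rewrite BB' !ind // big_cons /B' eqxx muleC; congr (_ * _)%E.
Qed.

Lemma integral_iid (k j : int) (f : R -> R) : measurable_fun setT f ->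
  (forall y, 0 <= f y) ->
  (\int[P]_t (f (omega k t))%:E = \int[P]_t (f (omega j t))%:E)%E.
Proof.
move=> mf f0; have [_ id_] := omega_iid.
have mEf : measurable_fun setT (EFin \o f) by exact/measurable_EFinP.
rewrite -(ge0_integral_distribution (omega k) mEf) //.
rewrite -(ge0_integral_distribution (omega j) mEf) //.
apply: (eq_measure_integral (distribution P (omega j))) => A mA _.
exact: id_.
Qed.

End IndependentOfTail.

Section AlmostSure.
Context {R : realType} {d : measure_display} {T : measurableType d}.
Variable P : probability T R.

(** The means are summable, so the series of the Z n is integrable, hence almost everywhere finite,
    and its terms tend to 0. *)
Lemma ae_cvg0_of_geometric_mean (Z : nat -> T -> R) (C q : R) :
    (forall n, measurable_fun setT (Z n)) -> (forall n t, 0 <= Z n t) ->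
    0 <= C -> 0 < q < 1 ->
    (forall n, (\int[P]_t (Z n t)%:E <= (C * q ^+ n)%:E)%E) ->
  {ae P, forall t, Z n t @[n --> \oo] --> (0 : R)}.
Proof.
move=> mZ Z0 C0 /andP[q0 q1] IZ.
have mEZ n : measurable_fun setT (fun t => (Z n t)%:E) by exact/measurable_EFinP.
have Z0' n t : (0 <= (Z n t)%:E)%E by rewrite lee_fin.
have iS : P.-integrable setT (fun t => \sum_(n <oo) (Z n t)%:E)%E.
  apply/integrableP; split; first exact: ge0_emeasurable_sum.
  under eq_integral do rewrite gee0_abs ?nneseries_ge0 //.
  rewrite integral_nneseries //.
  apply: (@le_lt_trans _ _ (\sum_(n <oo) (C * q ^+ n)%:E)%E).
    by apply: lee_nneseries => [n _ _|n _]; [exact: integral_ge0|exact: IZ].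
  have geo : series (geometric C q) @ \oo --> C * (1 - q)^-1.
    by apply: cvg_geometric_series; rewrite gtr0_norm.
  rewrite (_ : (\sum_(n <oo) _)%E = (C * (1 - q)^-1)%:E) ?ltry //.
  apply/cvg_lim => //.
  rewrite (_ : (fun n => _) = (fun n => (series (geometric C q) n)%:E)).
    by apply: cvg_comp geo _; exact: cvg_id.
  by apply/funext => n; rewrite /series /= -sumEFin.
have := integrable_ae measurableT iS; apply: filterS => t /(_ I) /= fin.
set S := (\sum_(n <oo) _)%E in fin.
apply: cvg_series_cvg_0; apply: nondecreasing_is_cvgn.
  by apply/nondecreasing_seqP => n; rewrite /series /= big_nat_recr //= lerDl.
exists (fine S) => _ [n _ <-]; rewrite -lee_fin fineK // /series /= -sumEFin.
exact: nneseries_lim_ge.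
Qed.

Lemma ae0_of_mean0 (F : T -> R) : measurable_fun setT F -> (forall t, 0 <= F t) ->
  (\int[P]_t (F t)%:E = 0)%E -> {ae P, forall t, F t = 0}.
Proof.
move=> mF F0 IF.
have mEF : measurable_fun setT (EFin \o F) by exact/measurable_EFinP.
have /(ae_eq_integral_abs P measurableT mEF) : (\int[P]_t `|(EFin \o F) t| = 0)%E.
  by rewrite -[RHS]IF; apply: eq_integral => t _; rewrite /= ger0_norm.
by apply: filterS => t /(_ I) [].
Qed.

Lemma ae_FalseP : {ae P, forall t, False} -> False.
Proof.
move=> [N [mN N0 sub]].
have : (P setT <= 0)%E by rewrite -N0 le_measure // ?inE // => t _; exact: sub.
by rewrite probability_setT lee_fin ler10.
Qed.

End AlmostSure.

(** * Almost sure estimates for the environment *)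

Section PowerInequalities.
Context {R : realType}.
Implicit Types (x y s k q : R).

(** Strict convexity of the power in its exponent. With c = s / k and u = k ln y, the tangent bounds
    for exp at (1 - c) u and at - c u are weighted by c and 1 - c; their linear terms cancel. *)
Lemma powR_lt_interpolation y s k : 0 < y -> y != 1 -> 0 < s < k ->
  y `^ s < 1 - s / k + s / k * y `^ k.
Proof.
move=> y0 y1 /andP[s0 sk]; have k0 := lt_trans s0 sk.
pose u := k * ln y; pose c := s / k.
have c0 : 0 < c by rewrite divr_gt0.
have c1 : c < 1 by rewrite ltr_pdivrMr // mul1r.
have u0 : u != 0 by apply: mulf_neq0; [rewrite gt_eqF|rewrite ln_eq0].
have yk : y `^ k = expR u by rewrite /powR gt_eqF.
have ys : y `^ s = expR (c * u).
  by rewrite /powR gt_eqF // /c /u mulrA divfK // gt_eqF.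
rewrite yk ys -/c.
have e0 := expR_gt0 (c * u).
have H1 : expR u = expR (c * u) * expR ((1 - c) * u) by rewrite -expRD; congr expR; ring.
have H2 : 1 = expR (c * u) * expR (- (c * u)) by rewrite -expRD subrr expR0.
have H3 : 1 + (1 - c) * u < expR ((1 - c) * u).
  by apply: expR_gt1Dx; rewrite mulf_neq0 // subr_eq0 gt_eqF.
have H4 : 1 - c * u <= expR (- (c * u)) by exact: expR_ge1Dx.
have H3' := H3; rewrite -(ltr_pM2l e0) -H1 in H3'.
have H4' := H4; rewrite -(ler_pM2l e0) -H2 in H4'.
nra.
Qed.

Lemma powR_le_interpolation y s k : 0 < y -> 0 < s < k ->
  y `^ s <= 1 - s / k + s / k * y `^ k.
Proof.
move=> y0 sk; have [->|y1] := eqVneq y 1; first by rewrite !powR1 mulr1 subrK.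
exact/ltW/powR_lt_interpolation.
Qed.

Lemma powR_subadditive x y q : 0 <= x -> 0 <= y -> 0 < q <= 1 ->
  (x + y) `^ q <= x `^ q + y `^ q.
Proof.
move=> x0 y0 /andP[q0 q1].
have [xy0|xy0] := eqVneq (x + y) 0.
  by rewrite xy0 powR0 ?gt_eqF // addr_ge0 ?powR_ge0.
have xy : 0 < x + y by rewrite lt_def xy0 addr_ge0.
(* On [0, 1] the power q <= 1 dominates the identity; the two fractions add up to 1. *)
have part z : 0 <= z -> z <= x + y -> z / (x + y) * (x + y) `^ q <= z `^ q.
  move=> z0 zxy; have [->|zn0] := eqVneq z 0; first by rewrite !mul0r powR_ge0.
  have -> : z `^ q = (z / (x + y)) `^ q * (x + y) `^ q.
    by rewrite -powRM ?divfK ?divr_ge0 // ltW.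
  rewrite ler_wpM2r ?powR_ge0 // ger1_powR // ler_pdivrMr // mul1r zxy andbT.
  by rewrite divr_gt0 // lt_def zn0.
have := part x x0; rewrite lerDl => /(_ y0) H1.
have := part y y0; rewrite lerDr => /(_ x0) H2.
apply: le_trans (lerD H1 H2).
by rewrite -mulrDl -mulrDl divff // mul1r.
Qed.

Lemma powR_sum_le (f : nat -> R) q n : (forall i, 0 <= f i) -> 0 < q <= 1 ->
  (\sum_(0 <= i < n) f i) `^ q <= \sum_(0 <= i < n) f i `^ q.
Proof.
move=> f0 q01; elim: n => [|n IH].
  by rewrite !big_nil powR0 //; case/andP: q01 => q0 _; rewrite gt_eqF.
rewrite !big_nat_recr //=.
apply: le_trans (powR_subadditive _ (f0 n) q01) _; first exact: sumr_ge0.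
by rewrite lerD2r.
Qed.

(** B may be arbitrarily close to 1, so that its product with a moment below 1 stays below 1; the
    price is the constant A. *)
Lemma powR_add2_le s B : 0 < s -> 1 < B ->
  exists2 A, 0 <= A & forall y, 0 <= y -> (2 + y) `^ s <= A + B * y `^ s.
Proof.
move=> s0 B1; pose b := B `^ s^-1.
have b1 : 1 < b.
  rewrite -(congr1 (fun f => f s^-1) (@powR1 R)) /b.
  by rewrite gt0_ltr_powR ?invr_gt0 // ?nnegrE; lra.
have bs : b `^ s = B.
  by rewrite /b -powRrM mulVf ?gt_eqF // powRr1 //; lra.
(* Beyond K one has 2 + y <= b y; up to K the constant (2 + K)^s is enough. *)
pose K := 2 / (b - 1).
have K0 : 0 < K by rewrite divr_gt0 // subr_gt0.
exists ((2 + K) `^ s); first exact: powR_ge0.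
move=> y y0; have [yK|Ky] := leP y K.
  rewrite -[leLHS]addr0; apply: lerD; last first.
    by rewrite mulr_ge0 ?powR_ge0 //; lra.
  by apply: ge0_ler_powR; rewrite ?nnegrE; lra.
rewrite -[leLHS]add0r; apply: lerD; first exact: powR_ge0.
rewrite -bs -powRM //; last by lra.
apply: ge0_ler_powR; rewrite ?nnegrE; [lra|lra|by rewrite mulr_ge0 //; lra|].
have : 2 <= (b - 1) * y.
  by move: Ky => /ltW; rewrite /K ler_pdivrMr ?subr_gt0 // mulrC.
lra.
Qed.

End PowerInequalities.

(** * Moments of rho of order below kappa *)

Section RhoMoments.
Context {R : realType} {d : measure_display} {T : measurableType d}.
Variables (P : probability T R) (omega : int -> {RV P >-> R}) (kappa : R).
Hypothesis omega01 : forall k t, 0 < omega k t < 1.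
Hypothesis omega_iid : iid omega.
Let rho_ t (k : nat) : R := rho (fun z => omega z t) k%:Z.
Hypothesis transient : ('E_P[fun t => ln (rho_ t 0)] < 0)%E.
Hypothesis kappa1 : ('E_P[fun t => (rho_ t 0 `^ kappa)%R] = 1)%E.

(* Agrees with rho ^ s for omega in ]0, 1[, and is defined through powR so as to
   be measurable and nonnegative on the whole line. *)
Definition rho_pow (s y : R) : R := ((1 - y) * y `^ (- 1)) `^ s.

Lemma rho_powE s t (k : nat) : rho_pow s (omega k t) = rho_ t k `^ s.
Proof.
by rewrite /rho_pow powR_inv1 //; have /andP[/ltW] := omega01 k t.
Qed.

Lemma measurable_rho_pow s : measurable_fun setT (rho_pow s).
Proof.
apply: (measurableT_comp (measurable_powR s)).
apply: measurable_funM; last exact: measurable_powR.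
by apply: measurable_funB => //; exact: measurable_cst.
Qed.

Lemma rho_pow_ge0 s y : 0 <= rho_pow s y.
Proof. exact: powR_ge0. Qed.

(** The gap D in the interpolation inequality is nonnegative, and its mean and that of rho^s add up
    to 1. A moment equal to 1 would force D = 0, hence rho = 1, almost everywhere, against the
    negative mean of ln rho. *)
Lemma rho_moment_lt1 s : 0 < s < kappa ->
  exists2 e : R, 0 <= e < 1 &
    forall k : nat, (\int[P]_t (rho_pow s (omega k t))%:E = e%:E)%E.
Proof.
move=> sk; have /andP[s0 _] := sk.
have mr u : measurable_fun setT (fun t => rho_pow u (omega 0%N t)).
  by apply: measurableT_comp => //; exact: measurable_rho_pow.
pose c := s / kappa.
have k0 : 0 < kappa by lra.
have c0 : 0 <= c by rewrite divr_ge0 // ltW.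
have c1 : c <= 1 by rewrite ler_pdivrMr // mul1r ltW //; case/andP: sk.
have r0 t : 0 < rho_ t 0 by exact: rho_gt0 (fun z => omega01 z t) 0%N.
pose D t := 1 - c + c * rho_pow kappa (omega 0%N t) - rho_pow s (omega 0%N t).
have D0 t : 0 <= D t.
  by rewrite /D !rho_powE subr_ge0 powR_le_interpolation.
have mD : measurable_fun setT D.
  apply: measurable_funB => //; apply: measurable_funD; first exact: measurable_cst.
  by apply: measurable_funM => //; exact: measurable_cst.
have Ik : (\int[P]_t (rho_pow kappa (omega 0%N t))%:E = 1)%E.
  by rewrite -kappa1 unlock; apply: eq_integral => t _; rewrite rho_powE.
have mEr u : measurable_fun setT (fun t => (rho_pow u (omega 0%N t))%:E).
  exact/measurable_EFinP.
have Er0 u t : setT t -> (0 <= (rho_pow u (omega 0%N t))%:E)%E.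
  by rewrite lee_fin rho_pow_ge0.
have mED : measurable_fun setT (fun t => (D t)%:E) by exact/measurable_EFinP.
have ED0 t : setT t -> (0 <= (D t)%:E)%E by rewrite lee_fin.
have ID : (\int[P]_t (D t)%:E + \int[P]_t (rho_pow s (omega 0%N t))%:E = 1)%E.
  rewrite -(ge0_integralD P measurableT ED0 mED (Er0 s) (mEr s)).
  transitivity (\int[P]_t ((1 - c)%:E + c%:E * (rho_pow kappa (omega 0%N t))%:E))%E.
    by apply: eq_integral => t _; rewrite -EFinD /D subrK EFinD EFinM.
  have c10 (t : T) : setT t -> (0 <= (fun=> (1 - c)%:E) t :> \bar R)%E.
    by rewrite lee_fin subr_ge0.
  have ck0 t : setT t -> (0 <= c%:E * (rho_pow kappa (omega 0%N t))%:E)%E.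
    by move=> ?; rewrite mule_ge0 ?lee_fin // rho_pow_ge0.
  have mck : measurable_fun setT (fun t => c%:E * (rho_pow kappa (omega 0%N t))%:E)%E.
    exact: measurable_funeM.
  rewrite (ge0_integralD P measurableT c10 (measurable_cst _) ck0 mck).
  have Ic : (\int[P]_t (fun=> (1 - c)%:E) t = (1 - c)%:E)%E.
    by rewrite integral_cst // -[RHS]mule1; congr (_ * _)%E; exact: probability_setT.
  rewrite Ic.
  rewrite (ge0_integralZl_EFin P measurableT (Er0 kappa) (mEr kappa)) //.
  by rewrite Ik mule1 -EFinD subrK.
have I0 : (0 <= \int[P]_t (rho_pow s (omega 0%N t))%:E)%E.
  by apply: integral_ge0 => t _; rewrite lee_fin rho_pow_ge0.
have ID0 : (0 <= \int[P]_t (D t)%:E)%E.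
  by apply: integral_ge0 => t _; rewrite lee_fin.
pose e := fine (\int[P]_t (rho_pow s (omega 0%N t))%:E)%E.
have eE : (\int[P]_t (rho_pow s (omega 0%N t))%:E = e%:E)%E.
  rewrite fineK // ge0_fin_numE //; apply: le_lt_trans (ltry 1).
  by rewrite -ID leeDr.
exists e; last first.
  by move=> k; rewrite -eE; apply: integral_iid => //; [exact: measurable_rho_pow|exact: rho_pow_ge0].
rewrite -lee_fin -eE I0 /= lt_neqAle; apply/andP; split; last first.
  by rewrite -lee_fin -eE -ID leeDr.
apply/eqP => e1.
have ID0' : (\int[P]_t (D t)%:E = 0)%E.
  move: ID; rewrite eE e1; case: (\int[P]_t (D t)%:E)%E ID0 => //= x _ [x1].
  by congr (_%:E); lra.
have aeD := ae0_of_mean0 mD D0 ID0'.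
have ln0 : {ae P, forall t, rho_ t 0 = 1}.
  apply: filterS aeD => t; rewrite /D !rho_powE => Dt.
  apply/eqP; apply: contraPT Dt => r1; apply/eqP.
  by rewrite gt_eqF // subr_gt0 powR_lt_interpolation.
suff I1 : ('E_P[fun t => ln (rho_ t 0)] = 0)%E by move: transient; rewrite I1 ltxx.
rewrite unlock -[RHS](integral0 P setT).
apply: ae_eq_integral => //.
- apply/measurable_EFinP.
  rewrite (_ : (fun t => _) = (@ln R) \o (fun t => rho_pow 1 (omega 0%N t))).
    by apply: measurableT_comp; [exact: measurable_ln|exact: mr].
  by apply/funext => t /=; rewrite rho_powE powRr1 // ltW.
- by apply: filterS ln0 => t -> _; rewrite ln1.
Qed.

End RhoMoments.

(** * Growth of the variance in a random environment *)

Section RandomEnvironment.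
Context {R : realType} {d : measure_display} {T : measurableType d}.
Variables (P : probability T R) (omega : int -> {RV P >-> R}) (kappa : R).
Hypothesis omega01 : forall k t, 0 < omega k t < 1.
Hypothesis omega_iid : iid omega.
Let rho_ t (k : nat) : R := rho (fun z => omega z t) k%:Z.
Hypothesis transient : ('E_P[fun t => ln (rho_ t 0)] < 0)%E.
Hypothesis kappa_gt1 : 1 < kappa.
Hypothesis kappa1 : ('E_P[fun t => (rho_ t 0 `^ kappa)%R] = 1)%E.

Let r_gt0 t k : 0 < rho_ t k.
Proof. exact: rho_gt0 (fun z => omega01 z t) k%:Z. Qed.

Section MomentBounds.
Variables (s A B : R).

(* Majorants of (1 + crossing_mean) ^ s and of crossing_var ^ (s / 2), each step
   of which involves only an independent factor. *)
Fixpoint mean_pow (t : T) (i : nat) : R :=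
  if i is j.+1 then A + B * (mean_pow t j * rho_pow s (omega i t)) else 2 `^ s.

Fixpoint var_pow (t : T) (i : nat) : R :=
  if i is j.+1 then
    var_pow t j * rho_pow (s / 2) (omega i t)
    + (mean_pow t j * rho_pow (s / 2) (omega i t) + mean_pow t j * rho_pow s (omega i t))
  else 0.

Hypothesis s12 : 1 < s <= 2.
Hypothesis A_ge0 : 0 <= A.
Hypothesis B_gt1 : 1 < B.
Hypothesis AB : forall y, 0 <= y -> (2 + y) `^ s <= A + B * y `^ s.

Let B_ge0 : 0 <= B.
Proof. exact: ltW (lt_trans ltr01 B_gt1). Qed.

(** In terms of 1 + mean the recursion is u -> 2 + rho u, which is the shape treated by [AB]. *)
Lemma mean_pow_ge t i : (1 + crossing_mean (rho_ t) i) `^ s <= mean_pow t i.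
Proof.
elim: i => [|i IH] /=; first by rewrite -natr1.
have m1 := crossing_mean_ge1 (r_gt0 t) i.
rewrite addrA -[1 + 1]/2%:R rho_powE //.
apply: (le_trans (AB _)); first by apply: mulr_ge0; [exact/ltW/r_gt0|lra].
rewrite lerD2l ler_wpM2l ?B_ge0 //.
rewrite powRM; [|exact/ltW/r_gt0|lra].
by rewrite mulrC ler_wpM2r // powR_ge0.
Qed.

(** As s / 2 <= 1, subadditivity splits the variance recursion, and splits rho (1 + rho) once more
    into the powers s / 2 and s of rho. *)
Lemma var_pow_ge t i : crossing_var (rho_ t) i `^ (s / 2) <= var_pow t i.
Proof.
have /andP[s1 s2] := s12.
have q01 : 0 < s / 2 <= 1 by lra.
have q0 : s / 2 != 0 by lra.
elim: i => [|i IH] /=; first by rewrite powR0.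
have m1 := crossing_mean_ge1 (r_gt0 t) i.
have v0 := crossing_var_ge0 (r_gt0 t) i.
have r0 := ltW (r_gt0 t i.+1).
have rv0 := mulr_ge0 r0 v0.
set x := 1 + crossing_mean _ _.
have x0 : 0 <= x by rewrite /x; lra.
have rr0 : 0 <= rho_ t i.+1 * (1 + rho_ t i.+1) by rewrite mulr_ge0 // addr_ge0.
apply: (le_trans (powR_subadditive _ _ _)) => //; first by rewrite mulr_ge0 // sqr_ge0.
have rpE u : rho_pow u (omega i.+1 t) = rho_ t i.+1 `^ u by exact: rho_powE.
rewrite !rpE; apply: lerD.
  by rewrite powRM // mulrC ler_wpM2r // powR_ge0.
rewrite powRM ?sqr_ge0 //.
have -> : (x ^+ 2) `^ (s / 2) = x `^ s.
  by rewrite -powR_mulrn // -powRrM mulrC divfK.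
rewrite [leRHS](_ : _ = (rho_ t i.+1 `^ (s / 2) + rho_ t i.+1 `^ s) * mean_pow t i);
  last by ring.
apply: ler_pM; rewrite ?powR_ge0 //; last exact: mean_pow_ge.
rewrite powRM ?addr_ge0 //.
have -> : rho_ t i.+1 `^ s = rho_ t i.+1 `^ (s / 2) * rho_ t i.+1 `^ (s / 2).
  by rewrite -powRD -?splitr //; apply/implyP => _; rewrite gt_eqF.
rewrite [leRHS](_ : _ = rho_ t i.+1 `^ (s / 2) * (1 + rho_ t i.+1 `^ (s / 2)));
  last by ring.
rewrite ler_wpM2l ?powR_ge0 //.
apply: (le_trans (powR_subadditive _ _ _)) => //.
by rewrite powR1.
Qed.

Variables (e e' : R).
Hypothesis e01 : 0 <= e < 1.
Hypothesis e'01 : 0 <= e' < 1.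
Hypothesis eE : forall k : nat, (\int[P]_t (rho_pow s (omega k t))%:E = e%:E)%E.
Hypothesis e'E : forall k : nat, (\int[P]_t (rho_pow (s / 2) (omega k t))%:E = e'%:E)%E.
Hypothesis Be : B * e < 1.

(** The quotient is the fixed point of u -> A + B e u, the recursion of the means; adding the
    initial value 2^s gives a bound for all iterates. *)
Let U := 2 `^ s + A / (1 - B * e).

Lemma mean_pow_bound i :
  exists2 g, mean_indep omega i.+1 (mean_pow^~ i) g & g <= U.
Proof.
have U1 : 0 <= A / (1 - B * e) by rewrite divr_ge0 // subr_ge0 ltW.
elim: i => [|i [g Hg gU]].
  exists (2 `^ s); last by rewrite /U lerDl.
  by apply: mean_indep_cst; exact: powR_ge0.
exists (A + B * (g * e)).
  apply: mean_indepD; first exact: mean_indep_cst.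
  apply: mean_indepZ => //; apply: mean_indepM => //.
  - exact: measurable_rho_pow.
  - exact: rho_pow_ge0.
have g0 := mean_indep_ge0 Hg; have /andP[e0 e1] := e01.
have H1 : B * (g * e) <= B * (U * e) by rewrite ler_wpM2l // ler_wpM2r.
apply: (le_trans (lerD (lexx A) H1)).
have H2 : A / (1 - B * e) * (1 - B * e) = A by rewrite divfK // subr_eq0 gt_eqF.
have p0 : 0 <= (2 : R) `^ s by exact: powR_ge0.
have H3 : B * e * 2 `^ s <= 2 `^ s by rewrite ler_piMl // ltW.
rewrite /U; set a := A / _ in H2 *; lra.
Qed.

(** Fixed point of v -> e' v + 2 U: each of the two terms containing [mean_pow] has mean at most
    U. *)
Let V := (2 * U) / (1 - e').

Lemma var_pow_bound i :
  exists2 g, mean_indep omega i.+1 (var_pow^~ i) g & g <= V.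
Proof.
have /andP[e0 e1] := e01; have /andP[e'0 e'1] := e'01.
have U0 : 0 <= U by rewrite addr_ge0 ?powR_ge0 // divr_ge0 // subr_ge0 ltW.
elim: i => [|i [g Hg gV]].
  exists 0; first exact: mean_indep_cst.
  by rewrite divr_ge0 ?mulr_ge0 // subr_ge0 ltW.
have [h Hh hU] := mean_pow_bound i; have h0 := mean_indep_ge0 Hh.
exists (g * e' + (h * e' + h * e)).
  by do 2 ?apply: mean_indepD; apply: mean_indepM => //;
    do ?[exact: measurable_rho_pow|exact: rho_pow_ge0].
have H2 : V * (1 - e') = 2 * U by rewrite divfK // subr_eq0 gt_eqF.
have H1 : g * e' <= V * e' by rewrite ler_wpM2r.
have H3 : h * e' <= U by rewrite (le_trans _ hU) // ler_piMr // ltW.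
have H4 : h * e <= U by rewrite (le_trans _ hU) // ler_piMr // ltW.
lra.
Qed.

Lemma measurable_var_pow i : measurable_fun setT (var_pow^~ i).
Proof. by have [g [] ] := var_pow_bound i. Qed.

Lemma var_pow_ge0 t i : 0 <= var_pow t i.
Proof. by have [g [_ H _] _] := var_pow_bound i; exact: H. Qed.

(* Along n = 2 ^ k the bound on the moment of order s / 2 of the variance is
   n^(1 - s) times the norming constant n ^ s, which is summable in k. *)
Lemma ae_var_to_small : {ae P, forall t, forall eps : R, 0 < eps ->
  \forall n \near \oo, var_to (rho_ t) n 0 <= eps * n%:R ^+ 2}.
Proof.
have /andP[s1 s2] := s12.
pose b : R := 2 `^ (- s).
have b0 : 0 < b by exact: powR_gt0.
have bs : 2 `^ s * b = 1 by rewrite /b powRN divff // gt_eqF // powR_gt0.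
pose Z k t := b ^+ k * \sum_(0 <= i < 2 ^ k) var_pow t i.
have U0 : 0 <= V.
  by have [g Hg gV] := var_pow_bound 0; exact: le_trans (mean_indep_ge0 Hg) gV.
have mZ k : measurable_fun setT (Z k).
  apply: measurable_funM; first exact: measurable_cst.
  by apply: measurable_sum => i; exact: measurable_var_pow.
have Z0 k t : 0 <= Z k t.
  by rewrite mulr_ge0 ?exprn_ge0 ?(ltW b0) // sumr_ge0 // => i _; exact: var_pow_ge0.
have h2 : (2 : R) < 2 `^ s.
  have ln2 : 0 < ln (2 : R) by rewrite ln_gt0 // ltr1n.
  rewrite /powR gt_eqF // -[ltLHS](@lnK R) ?posrE // ltr_expR.
  by rewrite -[ltLHS]mul1r ltr_pM2r.
have q01 : 0 < 2 * b < 1.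
  by rewrite mulr_gt0 //= -[ltRHS]bs ltr_pM2r.
have IZ k : (\int[P]_t (Z k t)%:E <= (V * (2 * b) ^+ k)%:E)%E.
  under eq_integral do rewrite EFinM -sumEFin.
  rewrite ge0_integralZl_EFin ?exprn_ge0 ?(ltW b0) //; last 2 first.
  - by move=> t _; apply: sume_ge0 => i _; rewrite lee_fin var_pow_ge0.
  - by apply: emeasurable_sum => i; apply/measurable_EFinP; exact: measurable_var_pow.
  rewrite ge0_integral_sum //; last 2 first.
  - by move=> i; apply/measurable_EFinP; exact: measurable_var_pow.
  - by move=> i t _; rewrite lee_fin var_pow_ge0.
  rewrite exprMn (mulrC (2 ^+ k)) mulrCA EFinM.
  apply: lee_wpmul2l; first by rewrite lee_fin exprn_ge0 // ltW.
  apply: (@le_trans _ _ (\sum_(0 <= i < 2 ^ k) V%:E)%E).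
    apply: lee_sum => i _; have [g Hg gV] := var_pow_bound i.
    by rewrite (mean_indepE Hg) lee_fin.
  by rewrite sumEFin sumr_const_nat subn0 -[V *+ _]mulr_natr natrX.
have := ae_cvg0_of_geometric_mean mZ Z0 U0 q01 IZ.
apply: filterS => t Zt eps eps0.
pose q := s / 2.
have q0 : 0 < q by rewrite /q; lra.
have q1 : q <= 1 by rewrite /q; lra.
(* The factor 4 pays for rounding n up to a power of two: if 2^j <= n < 2^(j+1), then (eps / 4)
   4^(j+1) = eps (2^j)^2 <= eps n^2. *)
have delta0 : 0 < (eps / 4) `^ q by rewrite powR_gt0 //; lra.
have /cvgrPdist_lt /(_ _ delta0) [K _ HK] := Zt.
have key k : (K <= k)%N -> var_to (rho_ t) (2 ^ k) 0 <= eps / 4 * 4 ^+ k.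
  move=> /HK /=; rewrite sub0r normrN ger0_norm // => ZK.
  rewrite leNgt; apply/negP => lt.
  have p0 : 0 <= eps / 4 * 4 ^+ k by rewrite mulr_ge0 ?exprn_ge0 //; lra.
  have v0 := var_to_ge0 (r_gt0 t) (2 ^ k) 0.
  have := gt0_ltr_powR q0 p0 v0 lt; rewrite powRM ?exprn_ge0 //; last by lra.
  have -> : ((4 : R) ^+ k) `^ q = (2 `^ s) ^+ k.
    rewrite -powR_mulrn // powRAC powR_mulrn ?powR_ge0 //; congr (_ ^+ _).
    have -> : (4 : R) = 2 `^ 2 by rewrite powR_mulrn //; ring.
    by rewrite -powRrM mulrC divfK.
  rewrite ltNge => /negP; apply.
  apply: (le_trans (powR_sum_le _ _ _)) => //; first by move=> i; exact: crossing_var_ge0.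
    by rewrite q0.
  apply: (@le_trans _ _ (\sum_(0 <= i < 2 ^ k) var_pow t i)).
    by apply: ler_sum => i _; exact: var_pow_ge.
  have bk : (2 `^ s) ^+ k * b ^+ k = 1 by rewrite -exprMn bs expr1n.
  have -> : \sum_(0 <= i < 2 ^ k) var_pow t i = Z k t * (2 `^ s) ^+ k.
    by rewrite mulrC /Z mulrA bk mul1r.
  by rewrite ler_wpM2r ?exprn_ge0 ?powR_ge0 // ltW.
exists (2 ^ K)%N => // n /= Kn.
have n0 : (0 < n)%N by apply: leq_trans Kn; rewrite expn_gt0.
have /andP[l1 l2] := trunc_log_bounds (isT : (1 < 2)%N) n0.
set j := trunc_log 2 n in l1 l2.
have Kj : (K <= j.+1)%N by rewrite ltnW // -(@ltn_exp2l 2) // (leq_ltn_trans Kn).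
have vle : var_to (rho_ t) n 0 <= var_to (rho_ t) (2 ^ j.+1) 0.
  rewrite /var_to [leRHS](big_cat_nat (leq0n n) (ltnW l2)) /= lerDl.
  by apply: sumr_ge0 => i _; exact: crossing_var_ge0.
apply: (le_trans vle); apply: (le_trans (key _ Kj)).
rewrite exprS mulrA divfK // ler_wpM2l ?(ltW eps0) //.
have -> : (4 : R) ^+ j = (2 ^ j)%:R ^+ 2.
  by rewrite natrX exprAC; congr (_ ^+ _); ring.
by rewrite lerXn2r ?nnegrE ?ler_nat.
Qed.

End MomentBounds.

Lemma ae_var_to_negligible : {ae P, forall t, forall eps : R, 0 < eps ->
  \forall n \near \oo, var_to (rho_ t) n 0 <= eps * n%:R ^+ 2}.
Proof.
(* Strictly between 1 and kappa, and at most 2. *)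
pose s : R := Num.min 2 ((1 + kappa) / 2).
have k1 : 1 < kappa by [].
have s1 : 1 < s by rewrite /s lt_min ltr1n /=; lra.
have s2 : s <= 2 by rewrite /s ge_min lexx.
have s12 : 1 < s <= 2 by rewrite s1.
have sk : s < kappa by rewrite /s gt_min; apply/orP; right; lra.
have [|e e01 eE] := rho_moment_lt1 omega01 omega_iid transient kappa1 (s := s).
  by lra.
have [|e' e'01 e'E] :=
    rho_moment_lt1 omega01 omega_iid transient kappa1 (s := s / 2).
  by lra.
have /andP[e0 e1] := e01.
(* This B exceeds 1, yet B e < 1; both follow from e < 1. *)
have B1 : 1 < 2 / (1 + e) by rewrite ltr_pdivlMr; lra.
have Be : 2 / (1 + e) * e < 1 by rewrite mulrAC ltr_pdivrMr; lra.
have [|A A0 AB] := powR_add2_le (s := s) _ B1; first by lra.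
exact: (ae_var_to_small s12 A0 B1 AB e01 e'01 eE e'E Be).
Qed.

(** The absolute value makes the integrand nonnegative on the whole line, as [mean_indepM] requires.
    A mean equal to 1 would make the positive variable 1 - omega vanish almost everywhere. *)
Lemma omega_mean_lt1 : exists2 m : R, 0 <= m < 1 &
  forall k : nat, (\int[P]_t `|omega k t|%:E = m%:E)%E.
Proof.
have w01 t : 0 < omega 0%N t < 1 := omega01 0%N t.
have m1 : measurable_fun setT (fun t => 1 - omega 0%N t).
  by apply: measurable_funB => //; exact: measurable_cst.
have mw : measurable_fun setT (fun t => `|omega 0%N t|).
  by apply: measurableT_comp => //.
have I1 : (\int[P]_t (1 - omega 0%N t)%:E + \int[P]_t `|omega 0%N t|%:E = 1)%E.
  rewrite -ge0_integralD //.
  - rewrite (eq_integral (cst 1%E)) ?integral_cst // ?mul1e.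
      exact: probability_setT.
    by move=> t _; rewrite -EFinD gtr0_norm ?subrK //; case/andP: (w01 t).
  - by move=> t _; rewrite lee_fin subr_ge0 ltW //; case/andP: (w01 t).
  - exact/measurable_EFinP.
  - exact/measurable_EFinP.
have I0 : (0 <= \int[P]_t `|omega 0%N t|%:E)%E.
  by apply: integral_ge0 => t _; rewrite lee_fin.
have J0 : (0 <= \int[P]_t (1 - omega 0%N t)%:E)%E.
  by apply: integral_ge0 => t _; rewrite lee_fin subr_ge0 ltW //; case/andP: (w01 t).
pose m := fine (\int[P]_t `|omega 0%N t|%:E)%E.
have mE : (\int[P]_t `|omega 0%N t|%:E = m%:E)%E.
  rewrite fineK // ge0_fin_numE //; apply: le_lt_trans (ltry 1).
  by rewrite -I1 leeDr.
exists m; last first.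
  move=> k; rewrite -mE; apply: (integral_iid omega_iid _ _ (f := fun y => `|y|)) => //.
rewrite -lee_fin -mE I0 /= lt_neqAle; apply/andP; split; last first.
  by rewrite -lee_fin -mE -I1 leeDr.
apply/eqP => m1'; apply: (@ae_FalseP _ _ _ P).
have J0' : (\int[P]_t (1 - omega 0%N t)%:E = 0)%E.
  move: I1; rewrite mE m1'; case: (\int[P]_t (1 - omega 0%N t)%:E)%E J0 => //= x _ [x1].
  by congr (_%:E); lra.
have m10 t : 0 <= 1 - omega 0%N t by rewrite subr_ge0 ltW //; case/andP: (w01 t).
have := ae0_of_mean0 m1 m10 J0'; apply: filterS => t t1.
by have /andP[_] := w01 t; rewrite -subr_gt0 t1 ltxx.
Qed.

Lemma ae_var_to_linear : {ae P, forall t, exists2 delta : R, 0 < delta &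
  \forall n \near \oo, delta * n%:R <= var_to (rho_ t) n 0}.
Proof.
have [m /andP[m0 m1] mE] := omega_mean_lt1.
(* Any rate strictly between the mean m and 1 would do: the product of n variables is then almost
   surely below c^n for large n. *)
pose c := (1 + m) / 2.
have c0 : 0 < c by rewrite /c; lra.
have c1 : c < 1 by rewrite /c; lra.
have mc : m < c by rewrite /c; lra.
pose W n t := \prod_(0 <= i < n) `|omega i.+1 t|.
have HW n : mean_indep omega n.+1 (W n) (m ^+ n).
  elim: n => [|n IH].
    rewrite expr0 (_ : W 0%N = fun=> 1); first exact: mean_indep_cst.
    by apply/funext => t; rewrite /W big_nil.
  rewrite (_ : W n.+1 = fun t => W n t * `|omega n.+1 t|).
    rewrite exprSr; apply: (mean_indepM omega_iid IH (f := fun y => `|y|)) => //.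
  by apply/funext => t; rewrite /W big_nat_recr.
have cn n : 0 <= (c ^+ n)^-1 by rewrite invr_ge0 exprn_ge0 // ltW.
have HZ n : mean_indep omega n.+1 (fun t => (c ^+ n)^-1 * W n t) ((c ^+ n)^-1 * m ^+ n).
  exact: mean_indepZ.
(* The midpoint of m / c and 1, which is positive even if m = 0. *)
pose q := (c + m) / (2 * c).
have q01 : 0 < q < 1 by rewrite divr_gt0 ?ltr_pdivrMr; lra.
have mcq : c^-1 * m <= q.
  have -> : q = c^-1 * ((c + m) / 2) by rewrite /q; field; rewrite gt_eqF.
  by rewrite ler_wpM2l ?invr_ge0 ?(ltW c0) //; lra.
have mZ n : measurable_fun setT (fun t => (c ^+ n)^-1 * W n t) by case: (HZ n).
have Z0 n t : 0 <= (c ^+ n)^-1 * W n t by case: (HZ n).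
have IZ n : (\int[P]_t ((c ^+ n)^-1 * W n t)%:E <= (1 * q ^+ n)%:E)%E.
  rewrite (mean_indepE (HZ n)) lee_fin mul1r -exprVn -exprMn.
  have q0 : 0 <= q by case/andP: q01 => /ltW.
  by rewrite lerXn2r ?nnegrE // mulr_ge0 // invr_ge0 ltW.
have := ae_cvg0_of_geometric_mean mZ Z0 ler01 q01 IZ.
apply: filterS => t Zt.
pose delta := - ln c.
have delta0 : 0 < delta by rewrite oppr_gt0 ln_lt0 // c0.
exists delta => //.
have /cvgrPdist_lt /(_ _ ltr01) [N _ HN] := Zt.
exists N.+2 => // -[//|n] /= Nn.
have nN : (N <= n)%N by rewrite -ltnS ltnW.
have Wc : W n t <= expR (- (n%:R * delta)).
  have := HN n nN; rewrite sub0r normrN ger0_norm // mulrC ltr_pdivrMr ?exprn_gt0 //.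
  rewrite mul1r => /ltW; rewrite /delta mulrN opprK mulrC expRM_natr lnK //.
have expW : expR (- \sum_(0 <= i < n) rho_ t i.+1) <= W n t.
  rewrite -sumrN expR_sum /W; apply: ler_prod => i _; rewrite expR_ge0 /=.
  have /andP[w0 w1] := omega01 i.+1%:Z t.
  rewrite gtr0_norm // expRN -[leRHS]invrK lef_pV2 ?posrE ?invr_gt0 ?expR_gt0 //.
  apply: le_trans (expR_ge1Dx _); rewrite /rho_ /rho mulrBl mul1r divff ?gt_eqF //.
  by rewrite addrC subrK.
have := le_trans expW Wc; rewrite ler_expR lerN2 => sumr.
(* The mean is at least 1, whence (1 + x)^2 >= 4. The factor 4 also compensates for the vanishing
   variance at index 0: 4 delta n >= delta (n + 1). *)
have cvr i : 4 * rho_ t i.+1 <= crossing_var (rho_ t) i.+1.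
  rewrite /=; have m1' := crossing_mean_ge1 (r_gt0 t) i.
  have v0 := crossing_var_ge0 (r_gt0 t) i; have r0 := r_gt0 t i.+1.
  set r := rho_ t i.+1 in r0 *; set x := crossing_mean _ _ in m1' *.
  have h4 : 4 <= (1 + x) ^+ 2 by nra.
  have h5 : 4 <= (1 + r) * (1 + x) ^+ 2 by nra.
  have := mulr_ge0 (ltW r0) v0; nra.
rewrite /var_to big_nat_recl //= add0r.
apply: (@le_trans _ _ (\sum_(0 <= i < n) 4 * rho_ t i.+1)); last first.
  by apply: ler_sum => i _; exact: cvr.
rewrite -mulr_sumr -natr1 mulrDr mulr1.
have n1 : 1 <= n%:R :> R by rewrite ler1n -ltnS; apply: leq_trans Nn.
have := ler_pM2l delta0 1 n%:R; rewrite n1 mulr1 => d1.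
rewrite mulrC in sumr *; lra.
Qed.

End RandomEnvironment.

(** * Cutoff *)

Section FixedSize.
Context {R : realType} {d : measure_display} {S : measurableType d}.
Variables (w : int -> R) (n : nat).
Hypothesis w01 : forall k, 0 < w k < 1.
Hypothesis n_gt0 : (0 < n)%N.
Variable Q : 'I_n.+1 -> probability S R.
Let r (k : nat) : R := rho w k.
Let r_gt0 k : 0 < r k.
Proof. exact: rho_gt0. Qed.

Let target_ord_max (y : 'I_n.+1) : y != ord_max -> (y < n <= n)%N.
Proof.
move=> yn; rewrite leqnn andbT ltn_neqAle -ltnS ltn_ord andbT.
by apply: contraNneq yn => yn; apply/eqP/val_inj.
Qed.

Section Walk.
Variable X : nat -> S -> 'I_n.+1.
Hypothesis mcX : markov_chain (Q ord0) (@walk_kernel R w n) ord0 X.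

Let walk_sum x : \sum_y @walk_kernel R w n x y = 1.
Proof.
transitivity (kernel_op (@walk_kernel R w n) (fun=> 1) x).
  by apply: eq_bigr => y _; rewrite mulr1.
by rewrite (walk_kernelE w n_gt0 (fun=> 1)); ring.
Qed.

Let m (y : 'I_n.+1) := mean_to r n y.
Let v (y : 'I_n.+1) := var_to r n y.

Let m_step y s : y != ord_max ->
  kernel_op (@walk_kernel R w n) (fun z => s + 1 + m z) y = s + m y.
Proof. by move=> /target_ord_max yn; exact: walk_mean_step. Qed.

Let v_step y a s : y != ord_max ->
  kernel_op (@walk_kernel R w n) (fun z => v z + (s + 1 + m z - a) ^+ 2) y
  = v y + (s + m y - a) ^+ 2.
Proof.
by move=> /target_ord_max yn; exact: (walk_moment_step w01 n_gt0 a s yn).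
Qed.

Lemma walk_time_mean : ('E_(Q ord0)[walk_time X] = (mean_to r n 0)%:E)%E.
Proof.
apply: (hitting_time_mean _ walk_sum mcX (b := ord_max) (m := m) (v := v)) => //.
- by move=> y z; exact: walk_kernel_ge0.
- by move=> y; exact: mean_to_ge0.
- by move=> y; exact: var_to_ge0.
- by rewrite /m /mean_to big_geq.
- by rewrite /v /var_to big_geq.
Qed.

Lemma walk_time_variance : ('V_(Q ord0)[walk_time X] = (var_to r n 0)%:E)%E.
Proof.
apply: (hitting_time_variance _ walk_sum mcX (b := ord_max) (m := m) (v := v)) => //.
- by move=> y z; exact: walk_kernel_ge0.
- by move=> y; exact: mean_to_ge0.
- by move=> y; exact: var_to_ge0.
- by rewrite /m /mean_to big_geq.
- by rewrite /v /var_to big_geq.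
Qed.

End Walk.

Variable Y : nat -> S -> 'I_n.+1.
Hypothesis mcY : forall x, markov_chain (Q x) (@lazy_kernel R w n) x Y.
Let L := kernel_op (@lazy_kernel R w n).
Let lazy_ge0 x y : 0 <= @lazy_kernel R w n x y.
Proof. exact: lazy_kernel_ge0. Qed.
Let lazy_sum x : \sum_y @lazy_kernel R w n x y = 1.
Proof. exact: lazy_kernel_sum. Qed.

Let stepE x l (B : {set 'I_n.+1}) :
  step_law Q Y x l B = iter l L (fun y => (y \in B)%:R) x.
Proof. exact: step_lawE. Qed.

Let iter_gt0 (x y : 'I_n.+1) l z : 0 < @lazy_kernel R w n x z ->
  0 < iter l L (fun u => (u \in [set y]%SET)%:R) z ->
  0 < iter l.+1 L (fun u => (u \in [set y]%SET)%:R) x.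
Proof.
move=> xz zy; rewrite iterS /L /kernel_op (bigD1 z) //= ltr_pwDl ?mulr_gt0 //.
apply: sumr_ge0 => u _; rewrite mulr_ge0 //.
have /andP[] // : 0 <= iter l L (fun u => (u \in [set y]%SET)%:R) u <= 1.
by apply: iter_kernel_op_itv => // u'; case: (_ \in _); rewrite ?lexx ?ler01.
Qed.

Let lazy_up (x y : 'I_n.+1) : y = x.+1 :> nat -> 0 < @lazy_kernel R w n x y.
Proof.
move=> yx; have xn : (x < n)%N by have := ltn_ord y; lia.
rewrite /lazy_kernel /walk_kernel -val_eqE /= yx eqxx ifF; last lia.
rewrite divr_gt0 // /reflected_env xn; case: ifP => // _.
by have /andP[] := w01 x.
Qed.

Let lazy_down (x y : 'I_n.+1) : x = y.+1 :> nat -> 0 < @lazy_kernel R w n x y.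
Proof.
move=> xy; rewrite /lazy_kernel /walk_kernel -val_eqE /= xy eqxx !ifF; [|lia|lia].
rewrite divr_gt0 // /reflected_env /= subr_gt0; case: ifP => // _.
by have /andP[] := w01 y.+1.
Qed.

Lemma lazy_irreducible : irreducible Q Y.
Proof.
move=> x y.
have up k : forall x : 'I_n.+1, (x + k = y)%N ->
    0 < iter k L (fun u => (u \in [set y]%SET)%:R) x.
  elim: k => [|k IH] z zy.
    by rewrite /= (_ : z = y) ?inE ?eqxx //; apply: val_inj; rewrite /= -zy addn0.
  have zn : (z < n)%N by have := ltn_ord y; lia.
  apply: (@iter_gt0 z y k (inord z.+1)); last by apply: IH; rewrite inordK; lia.
  by apply: lazy_up; rewrite inordK.
have down k : forall x : 'I_n.+1, (y + k = x)%N ->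
    0 < iter k L (fun u => (u \in [set y]%SET)%:R) x.
  elim: k => [|k IH] z zy.
    by rewrite /= (_ : z = y) ?inE ?eqxx //; apply: val_inj; rewrite /= -zy addn0.
  have z0 : (0 < z)%N by lia.
  have zn := ltn_ord z.
  apply: (@iter_gt0 z y k (inord z.-1)); last by apply: IH; rewrite inordK; lia.
  by apply: lazy_down; rewrite inordK ?prednK //; lia.
have [xy|/ltnW yx] := leqP x y.
  by exists (y - x)%N; rewrite stepE up // subnKC.
by exists (x - y)%N; rewrite stepE down // subnKC.
Qed.

Lemma lazy_aperiodic : aperiodic Q Y.
Proof.
move=> x g gP; apply/eqP; rewrite -dvdn1; apply: gP => //.
rewrite stepE; apply: (@iter_gt0 x x 0 x); last by rewrite /= inE eqxx.
by rewrite /lazy_kernel eqxx invr_gt0.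
Qed.

Let pi := @reversible_prob R w n.
Let pi_stat : stationary (@lazy_kernel R w n) pi.
Proof. exact: lazy_kernel_stationary. Qed.
Let pi_ge0 x : 0 <= pi x. Proof. by case: pi_stat. Qed.
Let pi_sum : \sum_x pi x = 1. Proof. by case: pi_stat. Qed.

Let pi_iter l (g : 'I_n.+1 -> R) : \sum_x pi x * iter l L g x = \sum_x pi x * g x.
Proof.
elim: l => [//|l <-]; rewrite iterS.
transitivity (\sum_x \sum_y pi x * (@lazy_kernel R w n x y * iter l L g y)).
  by apply: eq_bigr => x _; rewrite mulr_sumr.
rewrite exchange_big /=; apply: eq_bigr => y _.
under eq_bigr do rewrite mulrA.
by rewrite -mulr_suml; congr (_ * _); case: pi_stat.
Qed.

Let pi_set (B : {set 'I_n.+1}) : \sum_(y in B) pi y = \sum_x pi x * (x \in B)%:R.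
Proof.
by rewrite big_mkcond; apply: eq_bigr => x _; case: (x \in B); rewrite ?mulr1 ?mulr0.
Qed.

Let ind01 (B : {set 'I_n.+1}) y : 0 <= ((y \in B)%:R : R) <= 1.
Proof. by case: (_ \in _); rewrite ?lexx ?ler01. Qed.

Lemma mixing_distance_ge0 l : 0 <= mixing_distance Q Y pi l.
Proof. exact: bigmax_ge_id. Qed.

(** By stationarity, pi B is the pi-average of the l-step probabilities of B, so comparing two
    starting points is enough. *)
Lemma mixing_distance_le l (c : R) : 0 <= c ->
  (forall (B : {set 'I_n.+1}) x y, `|iter l L (fun y => (y \in B)%:R) x
                   - iter l L (fun y => (y \in B)%:R) y| <= c) ->
  mixing_distance Q Y pi l <= c.
Proof.
move=> c0 H; apply: bigmax_le => // x _; apply: bigmax_le => // B _.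
rewrite stepE pi_set -(pi_iter l).
set f := iter l L _.
have -> : f x - \sum_y pi y * f y = \sum_y pi y * (f x - f y).
  under [RHS]eq_bigr do rewrite mulrBr.
  by rewrite sumrB -mulr_suml pi_sum mul1r.
apply: le_trans (ler_norm_sum _ _ _) _.
apply: (@le_trans _ _ (\sum_y pi y * c)); last by rewrite -mulr_suml pi_sum mul1r.
by apply: ler_sum => y _; rewrite normrM ger0_norm // ler_wpM2l //; exact: H.
Qed.

Lemma mixing_distance_le1 l : mixing_distance Q Y pi l <= 1.
Proof.
apply: mixing_distance_le => // B x y.
have /andP[x0 x1] := iter_kernel_op_itv lazy_ge0 lazy_sum l x (ind01 B).
have /andP[y0 y1] := iter_kernel_op_itv lazy_ge0 lazy_sum l y (ind01 B).
rewrite ler_norml; lra.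
Qed.

(** The coupling bound is centred at the lazy mean from the lower starting point; mean and variance
    are largest, and the distance to l smallest, when that point is 0. *)
Lemma mixing_distance_upper l : 2 * mean_to r n 0 < l%:R ->
  mixing_distance Q Y pi l <=
    (4 * var_to r n 0 + 2 * mean_to r n 0) / (l%:R - 2 * mean_to r n 0) ^+ 2.
Proof.
move=> Ml; have D0 : 0 < (l%:R - 2 * mean_to r n 0) ^+ 2.
  by rewrite exprn_gt0 // subr_gt0.
have V0 := var_to_ge0 r_gt0 n 0; have M0 := mean_to_ge0 r_gt0 n 0.
apply: mixing_distance_le.
  by apply: divr_ge0; [lra|exact: ltW].
move=> B; set f := iter l L _.
have key (x y : 'I_n.+1) : (x <= y)%N -> `|f x - f y| <=
    (4 * var_to r n 0 + 2 * mean_to r n 0) / (l%:R - 2 * mean_to r n 0) ^+ 2.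
  move=> xy; rewrite ler_pdivlMr // mulrC.
  have mx := mean_to_le r_gt0 n x; have vx := var_to_le r_gt0 n x.
  have ax : 2 * mean_to r n x <= l%:R by lra.
  have := lazy_coupling w01 n_gt0 (ind01 B) (leqnn l) ax xy.
  rewrite subnn /lazy_moment -/r add0r subrr expr0n addr0 => H.
  apply: le_trans (le_trans H _); last lra.
  by rewrite ler_wpM2r // lerXn2r ?nnegrE; lra.
move=> x y; have [xy|/ltnW yx] := leqP x y; first exact: key.
by rewrite distrC; exact: key.
Qed.

(** The test set is [m, n] for the quantile m. D bounds the mean time from m to n and is doubled by
    laziness, so that 2 E T_m is still beyond l and Chebyshev's inequality applies to the hitting
    time of m. *)
Lemma mixing_distance_lower (eps D : R) l : 0 < eps < 1 -> 0 <= D ->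
    (2 + 2 / eps) * var_to r n 0 + 2 * n%:R <= D ^+ 2 ->
    l%:R < 2 * mean_to r n 0 - 2 * D ->
  1 - eps - (4 * var_to r n 0 + 2 * mean_to r n 0)
              / (2 * mean_to r n 0 - 2 * D - l%:R) ^+ 2
    <= mixing_distance Q Y pi l.
Proof.
move=> eps01 D0 DV lM.
have [m mn [pim Em]] := quantile_mean_le w01 n_gt0 eps01.
have mD : mean_to r n m <= D.
  rewrite -(@ler_pXn2r _ 2) ?nnegrE //; last exact: mean_to_ge0.
  exact: le_trans Em DV.
have split_mean : mean_to r n 0 = mean_to r m 0 + mean_to r n m.
  by rewrite /mean_to (big_cat_nat (leq0n m) mn).
have split_var : var_to r n 0 = var_to r m 0 + var_to r n m.
  by rewrite /var_to (big_cat_nat (leq0n m) mn).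
have V0 := var_to_ge0 r_gt0 n m; have M0 := mean_to_ge0 r_gt0 n m.
have V0' := var_to_ge0 r_gt0 m 0; have M0' := mean_to_ge0 r_gt0 m 0.
pose B := [set y : 'I_n.+1 | (m <= y)%N]%SET.
pose f := iter l L (fun y : 'I_n.+1 => (m <= y)%N%:R).
have fE : iter l L (fun y => (y \in B)%:R) ord0 = f ord0.
  by rewrite /f; congr (iter l L _ _); apply/funext => y; rewrite inE.
have la : l%:R <= 2 * mean_to r m 0 by lra.
have := lazy_lower_tail w01 n_gt0 ord0 mn (leqnn l) la.
rewrite -/L -/f subnn /lazy_moment -/r add0r subrr expr0n addr0 => fU.
have DD0 : 0 < (2 * mean_to r n 0 - 2 * D - l%:R) ^+ 2.
  by rewrite exprn_gt0 // subr_gt0.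
have /andP[f0 f1] : 0 <= f ord0 <= 1.
  by rewrite -fE; exact: (iter_kernel_op_itv lazy_ge0 lazy_sum l ord0 (ind01 B)).
have fle : f ord0 <= (4 * var_to r n 0 + 2 * mean_to r n 0)
              / (2 * mean_to r n 0 - 2 * D - l%:R) ^+ 2.
  rewrite ler_pdivlMr // mulrC; apply: (@le_trans _ _
    ((2 * mean_to r m 0 - l%:R) ^+ 2 * f ord0)).
    by rewrite ler_wpM2r // lerXn2r ?nnegrE; lra.
  apply: le_trans fU _; lra.
have piB : 1 - eps <= \sum_(y in B) pi y.
  rewrite lerBlDr -pi_sum (bigID (fun y => y \in B)) /= lerD2l.
  rewrite (eq_bigl (fun x : 'I_n.+1 => (x < m)%N)) //.
  by move=> y; rewrite inE -ltnNge.
pose tv x (A : {set 'I_n.+1}) := `|step_law Q Y x l A - \sum_(y in A) pi y|.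
have tvB : tv ord0 B <= \big[Num.max/0]_A tv ord0 A by exact: le_bigmax.
have tv0 : \big[Num.max/0]_A tv ord0 A <= \big[Num.max/0]_x \big[Num.max/0]_A tv x A.
  exact: (le_bigmax _ (fun x => \big[Num.max/0]_A tv x A)).
apply: le_trans (le_trans tvB tv0).
rewrite /tv stepE fE distrC; apply: le_trans (ler_norm _); lra.
Qed.

End FixedSize.

(** * Bounds on upper and lower limits *)

Section LimsupBounds.
Context {R : realType}.

Lemma limn_esup_le_near (u : nat -> \bar R) a :
  (\forall n \near \oo, u n <= a)%E -> (limn_esup u <= a)%E.
Proof.
move=> ua; apply: (@le_trans _ _ (ereal_sup (u @` [set n | u n <= a]%E))).
  by apply: ereal_inf_lbound; exists [set n | u n <= a]%E.
by apply: ge_ereal_sup => _ [n /= una <-].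
Qed.

Lemma limn_esup_ge_near (u : nat -> \bar R) a :
  (\forall n \near \oo, a <= u n)%E -> (a <= limn_esup u)%E.
Proof.
move=> [N _ aN]; apply: le_ereal_inf_tmp => _ [V [M _ MV] <-].
apply: (@le_trans _ _ (u (maxn N M))).
  by apply: aN => /=; exact: leq_maxl.
by apply: ereal_sup_ubound; exists (maxn N M) => //; apply: MV => /=; exact: leq_maxr.
Qed.

Lemma limn_einf_ge_near (u : nat -> \bar R) a :
  (\forall n \near \oo, a <= u n)%E -> (a <= limn_einf u)%E.
Proof.
move=> au; rewrite /limn_einf leeNr; apply: limn_esup_le_near.
by apply: filterS au => n; rewrite leeN2.
Qed.

Lemma limn_einf_le_near (u : nat -> \bar R) a :
  (\forall n \near \oo, u n <= a)%E -> (limn_einf u <= a)%E.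
Proof.
move=> ua; rewrite /limn_einf leeNl; apply: limn_esup_ge_near.
by apply: filterS ua => n; rewrite leeN2.
Qed.

Lemma cvge_pinfty_near (F : R -> \bar R) (l : R) :
  (forall e : R, 0 < e -> \forall c \near +oo, ((l - e)%:E <= F c <= (l + e)%:E)%E) ->
  F c @[c --> +oo] --> l%:E.
Proof.
move=> H.
have fin c e : ((l - e)%:E <= F c <= (l + e)%:E)%E -> F c \is a fin_num.
  move=> /andP[h1 h2]; rewrite fin_numElt (lt_le_trans _ h1) ?ltNyr //.
  by rewrite (le_lt_trans h2) ?ltry.
apply/fine_cvgP; split.
  by apply: filterS (H 1 ltr01) => c; exact: fin.
apply/cvgrPdist_le => e e0; apply: filterS (H e e0) => c Fc /=.
move: (Fc); rewrite -(fineK (fin _ _ Fc)) !lee_fin => /andP[h1 h2].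
by rewrite ler_norml; lra.
Qed.

End LimsupBounds.

(** * Cutoff in a fixed environment with controlled variance *)

Section FixedEnvironment.
Context {R : realType}.
Variable w : int -> R.
Hypothesis w01 : forall k, 0 < w k < 1.
Let r (k : nat) : R := rho w k.
Let r_gt0 k : 0 < r k.
Proof. exact: rho_gt0. Qed.
Let M n := mean_to r n 0.
Let V n := var_to r n 0.
Hypothesis V_small : forall eps : R, 0 < eps ->
  \forall n \near \oo, V n <= eps * n%:R ^+ 2.
Variable delta : R.
Hypothesis delta_gt0 : 0 < delta.
Hypothesis V_linear : \forall n \near \oo, delta * n%:R <= V n.

Let V_ge0 n : 0 <= V n. Proof. exact: var_to_ge0. Qed.
Let M_ge n : n%:R <= M n. Proof. exact: mean_to_size. Qed.

(** Edge by edge, cm <= 2 + (cm - 1)^2 <= 2 + cv. *)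
Lemma mean_to_le_var n : M n <= 2 * n%:R + V n.
Proof.
have -> : 2 * n%:R = \sum_(0 <= i < n) (2 : R).
  by rewrite sumr_const_nat subn0 -[RHS]mulr_natr.
rewrite /M /V /mean_to /var_to -big_split /=; apply: ler_sum => i _.
have := crossing_var_ge_sqr w01 i; rewrite -/r.
have := sqr_ge0 (crossing_mean r i - 2); nra.
Qed.

(** From 4 V + 2 M <= 6 V + 4 n and n <= V / delta. *)
Let K := 6 + 4 / delta.
Let K_gt0 : 0 < K.
Proof. by rewrite addr_gt0 // divr_gt0. Qed.

Let moments_near :
  \forall n \near \oo, 4 * V n + 2 * M n <= K * V n /\ 2 * n%:R <= 2 / delta * V n.
Proof.
apply: filterS V_linear => n Vn.
have H : 2 * n%:R <= 2 / delta * V n by rewrite mulrAC ler_pdivlMr // -mulrA ler_wpM2l // mulrC.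
split => //; have := mean_to_le_var n; have -> : K * V n = 6 * V n + 2 * (2 / delta * V n).
  by rewrite /K; field; rewrite gt_eqF.
lra.
Qed.

Let V_large (a : R) : \forall n \near \oo, a <= V n.
Proof.
apply: filterS2 V_linear (nbhs_infty_ger (a / delta)) => n Vn an.
by apply: le_trans Vn; rewrite mulrC -ler_pdivrMr.
Qed.

Let sqrtV_small (eps : R) : 0 < eps ->
  \forall n \near \oo, Num.sqrt (V n) <= eps * n%:R.
Proof.
move=> eps0; have eps2 : 0 < eps ^+ 2 by rewrite exprn_gt0.
apply: filterS (V_small eps2) => n Vn.
rewrite -[leRHS]ger0_norm ?mulr_ge0 ?(ltW eps0) // -sqrtr_sqr ler_sqrt ?sqr_ge0 //.
by rewrite exprMn.
Qed.

Variables (d' : measure_display) (S : nat -> measurableType d').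
Variables (Q : forall n, 'I_n.+1 -> probability (S n) R).
Variables X Y : forall n, nat -> S n -> 'I_n.+1.
Hypothesis mcXY : forall n, (0 < n)%N -> forall z : 'I_n.+1,
  markov_chain (@Q n z) (@walk_kernel R w n) z (@X n) /\
  markov_chain (@Q n z) (@lazy_kernel R w n) z (@Y n).

Let dist n (t : R) :=
  mixing_distance (@Q n) (@Y n) (@reversible_prob R w n) (Num.truncn t).
Let f n : R := Num.sqrt (V n).

Let mcY n : (0 < n)%N -> forall z, markov_chain (@Q n z) (@lazy_kernel R w n) z (@Y n).
Proof. by move=> n0 z; have [] := mcXY n0 z. Qed.

Lemma dist_after_cutoff (c : R) : 2 <= c ->
  \forall n \near \oo, 0 <= dist n (2 * M n + c * f n) <= 4 * K / c ^+ 2.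
Proof.
move=> c2; near=> n.
have n0 : (0 < n)%N by near: n; exists 1%N.
have [VK _] : 4 * V n + 2 * M n <= K * V n /\ 2 * n%:R <= 2 / delta * V n by near: n.
have V1 : 1 <= V n by near: n; exact: V_large.
have f1 : 1 <= f n by rewrite -sqrtr1 ler_sqrt.
have ff : f n ^+ 2 = V n by rewrite sqr_sqrtr.
set l := Num.truncn (2 * M n + c * f n).
have lM : 2 * M n + c * f n < l%:R + 1 by rewrite natr1 truncnS_gt.
have cf : 2 * f n <= c * f n by rewrite ler_wpM2r //; lra.
(* Rounding down costs at most 1, and 1 <= c f / 2 because c >= 2 and f >= 1. *)
have lM2 : c / 2 * f n <= l%:R - 2 * M n by lra.
have Ml : 2 * M n < l%:R by lra.
rewrite mixing_distance_ge0 /=.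
apply: le_trans (mixing_distance_upper w01 n0 (mcY n0) Ml) _.
have c0 : 0 < c by lra.
have D0 : 0 < (l%:R - 2 * M n) ^+ 2 by rewrite exprn_gt0 // subr_gt0.
rewrite ler_pdivrMr //; apply: le_trans VK _.
apply: (@le_trans _ _ (4 * K / c ^+ 2 * (c / 2 * f n) ^+ 2)).
  by rewrite -ff le_eqVlt; apply/orP; left; apply/eqP; field; rewrite gt_eqF.
apply: ler_wpM2l.
  by rewrite divr_ge0 ?mulr_ge0 ?sqr_ge0 // ltW.
have f0 : 0 <= f n by exact: sqrtr_ge0.
have c20 : 0 <= c / 2 by lra.
by rewrite lerXn2r ?nnegrE ?mulr_ge0 ?subr_ge0 // ltW.
Unshelve. all: by end_near. Qed.

(** The number b is such that D = b f satisfies the hypothesis of [mixing_distance_lower]: its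
    square is (2 + 2 / eps) V plus (2 / delta) V, and the latter dominates 2 n. *)
Lemma dist_before_cutoff (eps c : R) : 0 < eps < 1 ->
    let b := Num.sqrt (2 + 2 / eps + 2 / delta) in
    2 * b < c ->
  \forall n \near \oo,
    1 - eps - K / (c - 2 * b) ^+ 2 <= dist n (2 * M n - c * f n) <= 1.
Proof.
move=> eps01 b bc; have /andP[eps0 eps1] := eps01.
have b0 : 0 <= b by exact: sqrtr_ge0.
have bb : b ^+ 2 = 2 + 2 / eps + 2 / delta.
  rewrite sqr_sqrtr // !addr_ge0 // divr_ge0 //; exact: ltW.
have c0 : 0 < c by lra.
near=> n.
have n0 : (0 < n)%N by near: n; exists 1%N.
have [VK nV] : 4 * V n + 2 * M n <= K * V n /\ 2 * n%:R <= 2 / delta * V n by near: n.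
have V1 : 1 <= V n by near: n; exact: V_large.
have f1 : 1 <= f n by rewrite -sqrtr1 ler_sqrt.
have ff : f n ^+ 2 = V n by rewrite sqr_sqrtr.
(* Since n <= M, the time 2 M - c f is nonnegative, so that its truncation is a genuine rounding
   down and not the default 0. *)
have cf : c * f n <= n%:R.
  rewrite mulrC -ler_pdivlMr // mulrC; near: n.
  by apply: sqrtV_small; rewrite invr_gt0.
have Mn := M_ge n; have nn : 0 <= n%:R :> R by [].
have t0 : 0 <= 2 * M n - c * f n by lra.
rewrite (mixing_distance_le1 w01 n0 (mcY n0)) andbT.
set l := Num.truncn (2 * M n - c * f n).
have lt : l%:R <= 2 * M n - c * f n by rewrite truncn_le.
have gap : (c - 2 * b) * f n <= 2 * M n - 2 * (b * f n) - l%:R.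
  have -> : (c - 2 * b) * f n = c * f n - 2 * (b * f n) by ring.
  lra.
have fpos : 0 < f n by exact: lt_le_trans ltr01 f1.
have g0 : 0 < (c - 2 * b) * f n by rewrite mulr_gt0 ?subr_gt0.
have D0 : 0 <= b * f n by rewrite mulr_ge0 // ltW.
have DV : (2 + 2 / eps) * V n + 2 * n%:R <= (b * f n) ^+ 2.
  by rewrite exprMn ff bb (mulrDl _ (2 / delta)) lerD2l.
have lM : l%:R < 2 * M n - 2 * (b * f n) by lra.
apply: le_trans (mixing_distance_lower w01 n0 (mcY n0) eps01 D0 DV lM).
rewrite lerD2l lerN2 ler_pdivrMr; last first.
  by rewrite exprn_gt0 //; exact: lt_le_trans g0 gap.
apply: le_trans VK _.
apply: (@le_trans _ _ (K / (c - 2 * b) ^+ 2 * ((c - 2 * b) * f n) ^+ 2)).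
  rewrite -ff le_eqVlt; apply/orP; left; apply/eqP; field.
  by rewrite gt_eqF // subr_gt0.
apply: ler_wpM2l; first by rewrite divr_ge0 ?sqr_ge0 // ltW.
by rewrite lerXn2r ?nnegrE //; [exact: ltW|exact: le_trans (ltW g0) gap].
Unshelve. all: by end_near. Qed.

Lemma cutoff_of_environment :
  exhibits_cutoff (@Q) (fun n => @lazy_kernel R w n) (@Y)
    (fun n => 2 * fine ('E_(@Q n ord0)[walk_time (@X n)])%E)
    (fun n => Num.sqrt (fine 'V_(@Q n ord0)[walk_time (@X n)])).
Proof.
have tE n : (0 < n)%N -> 2 * fine ('E_(@Q n ord0)[walk_time (@X n)])%E = 2 * M n.
  by move=> n0; rewrite (walk_time_mean w01 n0 (mcXY n0 ord0).1).
have fE n : (0 < n)%N -> Num.sqrt (fine 'V_(@Q n ord0)[walk_time (@X n)]) = f n.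
  by move=> n0; rewrite (walk_time_variance w01 n0 (mcXY n0 ord0).1).
split.
- move=> n n0; split.
  + exact: mcY.
  + exact: lazy_irreducible (mcY n0).
  + exact: lazy_aperiodic (mcY n0).
- apply/cvgryPge => a; near=> n; rewrite card_ord.
  apply: (@le_trans _ _ n%:R); last by rewrite ler_nat.
  by near: n; exact: nbhs_infty_ger.
exists (fun n => @reversible_prob R w n); split.
- by move=> n n0; exact: lazy_kernel_stationary.
- apply/eqoP => eps eps0; near=> n.
  have n0 : (0 < n)%N by near: n; exists 1%N.
  rewrite tE // fE // ger0_norm ?sqrtr_ge0 //.
  rewrite ger0_norm ?mulr_ge0 //; last exact: mean_to_ge0.
  apply: (@le_trans _ _ (eps * n%:R)); first by near: n; exact: sqrtV_small.
  rewrite ler_wpM2l ?(ltW eps0) //; have := M_ge n; have : 0 <= n%:R :> R by [].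
  lra.
- apply: cvge_pinfty_near => e e0.
  pose eps := Num.min (e / 2) (1 / 2).
  have eps01 : 0 < eps < 1 by rewrite lt_min gt_min; lra.
  have epse : eps <= e / 2 by rewrite ge_min lexx.
  pose b := Num.sqrt (2 + 2 / eps + 2 / delta).
  near=> c.
  have b0 : 0 <= b by exact: sqrtr_ge0.
  (* The summand 1 gives a >= 1, so that c - 2 b >= a implies (c - 2 b)^2 >= a. *)
  pose a := K / (e / 2) + 1.
  have a1 : 1 <= a by rewrite /a lerDr; apply: divr_ge0; [exact: ltW|rewrite divr_ge0 // ltW].
  have ca : 2 * b + a <= c by near: c; by apply: nbhs_pinfty_ge; rewrite num_real.
  have bc : 2 * b < c by lra.
  have Kc : K / (c - 2 * b) ^+ 2 <= e / 2.
    rewrite ler_pdivrMr; last by rewrite exprn_gt0 // subr_gt0.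
    have aa : a <= (c - 2 * b) ^+ 2.
      apply: (@le_trans _ _ (a * a)); first by rewrite ler_peMl; lra.
      by rewrite expr2 ler_pM; lra.
    rewrite mulrC -ler_pdivrMr ?divr_gt0 //; apply: le_trans aa.
    by rewrite /a lerDl.
  have H := dist_before_cutoff eps01 bc.
  have {}H : \forall n \near \oo, ((1 - e)%:E <=
     (mixing_distance (@Q n) (@Y n) (@reversible_prob R w n) (Num.truncn
      (2 * fine ('E_(@Q n ord0)[walk_time (@X n)])%E -
       c * Num.sqrt (fine 'V_(@Q n ord0)[walk_time (@X n)]))))%R%:E <= 1%:E)%E.
    near=> n; have n0 : (0 < n)%N by near: n; exists 1%N.
    rewrite tE // fE // !lee_fin.
    have : 1 - eps - K / (c - 2 * b) ^+ 2 <= dist n (2 * M n - c * f n) <= 1 by near: n.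
    by move=> /andP[h1 h2]; apply/andP; split => //; apply: le_trans h1; lra.
  apply/andP; split.
    by apply: limn_einf_ge_near; apply: filterS H => n /andP[].
  apply: (@le_trans _ _ 1%:E); last by rewrite lee_fin; lra.
  by apply: limn_einf_le_near; apply: filterS H => n /andP[].
- apply: cvge_pinfty_near => e e0; near=> c.
  have ca : 4 * K / e + 2 <= c by near: c; by apply: nbhs_pinfty_ge; rewrite num_real.
  have Ke : 0 <= 4 * K / e by rewrite divr_ge0 ?mulr_ge0 // ltW.
  have c2 : 2 <= c by lra.
  have c0 : 0 < c by lra.
  have Kc : 4 * K / c ^+ 2 <= e.
    rewrite ler_pdivrMr ?exprn_gt0 //.
    rewrite [leRHS]mulrC -ler_pdivrMr // expr2.
    by apply: (@le_trans _ _ c); [lra|rewrite ler_peMl; lra].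
  have H := dist_after_cutoff c2.
  have {}H : \forall n \near \oo, (0%:E <=
     (mixing_distance (@Q n) (@Y n) (@reversible_prob R w n) (Num.truncn
      (2 * fine ('E_(@Q n ord0)[walk_time (@X n)])%E +
       c * Num.sqrt (fine 'V_(@Q n ord0)[walk_time (@X n)]))))%R%:E <= e%:E)%E.
    near=> n; have n0 : (0 < n)%N by near: n; exists 1%N.
    rewrite tE // fE // !lee_fin.
    have : 0 <= dist n (2 * M n + c * f n) <= 4 * K / c ^+ 2 by near: n.
    by move=> /andP[h1 h2]; rewrite h1 /=; exact: le_trans h2 Kc.
  rewrite sub0r add0r; apply/andP; split.
    apply: (@le_trans _ _ 0%:E); first by rewrite lee_fin; lra.
    by apply: limn_esup_ge_near; apply: filterS H => n /andP[].
  by apply: limn_esup_le_near; apply: filterS H => n /andP[].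
Unshelve. all: by end_near. Qed.

End FixedEnvironment.

(** The exceptional null set comes from the two variance estimates alone; outside it the cutoff is a
    deterministic statement about the environment, valid for every realization of the chains. *)
Theorem theorem1p4 (R : realType) (d : measure_display) (T : measurableType d)
    (P : probability T R) (omega : int -> {RV P >-> R}) (kappa : R)
    (rho0 := fun t : T => rho (fun k => omega k t) 0)
    (kappa_cond := fun k : R =>
      [/\ 0 < k, ('E_P[fun t => (rho0 t `^ k)%R] = 1)%E
        & ('E_P[fun t => (rho0 t `^ k * Num.max (ln (rho0 t)) 0)%R] < +oo)%E])
    (omega01 : forall k t, 0 < omega k t < 1)
    (omega_iid : iid omega)
    (transient : ('E_P[fun t => ln (rho0 t)] < 0)%E)
    (kappaP : kappa_cond kappa)
    (kappa_unique : forall k, kappa_cond k -> k = kappa)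
    (kappa_gt1 : 1 < kappa) :
  {ae P, forall t : T,
    let w := fun k => omega k t in
    forall (d' : measure_display) (S : nat -> measurableType d')
      (Q : forall n, 'I_n.+1 -> probability (S n) R)
      (X Y : forall n, nat -> S n -> 'I_n.+1),
    (forall n, (0 < n)%N -> forall z : 'I_n.+1,
       markov_chain (Q n z) (@walk_kernel R w n) z (X n) /\
       markov_chain (Q n z) (@lazy_kernel R w n) z (Y n)) ->
    exhibits_cutoff Q (fun n => @lazy_kernel R w n) Y
      (fun n => 2 * fine ('E_(Q n ord0)[walk_time (X n)])%E)
      (fun n => Num.sqrt (fine 'V_(Q n ord0)[walk_time (X n)]))}.
Proof.
have [_ kappa1 _] := kappaP.
have small := ae_var_to_negligible omega01 omega_iid transient kappa_gt1 kappa1.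
have linear := ae_var_to_linear omega01 omega_iid.
apply: filterS2 small linear => t Vs [delta delta0 Vl] d' S Q X Y mcXY.
exact: (cutoff_of_environment (fun k => omega01 k t) Vs delta0 Vl mcXY).
Qed.
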